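(* Let $\Lambda$ be any finite simple graph. Then there exists a finite simple graph $\Gamma'=\Gamma'(\Lambda)$ such that (1) $A_\Lambda \cong \mathrm{PSO}(A_{\Gamma'})$, (2) $\mathrm{PSO}(A_{\Gamma'})$ has finite index in $\mathrm{Out}(A_{\Gamma'})$, and (3) $\Gamma'$ has no non-trivial graph automorphisms.
   Context: All graphs are finite, undirected, without loops or multiple edges. For a graph $\Gamma$, the right-angled Artin group is $A_\Gamma = \langle V(\Gamma) \mid [v,w]=1 \text{ for } \{v,w\}\in E(\Gamma)\rangle$ (for the graph with no vertices, $A_\emptyset$ is the trivial group). An automorphism $\phi$ of $A_\Gamma$ is pure symmetric if for every vertex $v$, $\phi(v)$ is a conjugate of $v$ (the conjugating element may depend on $v$); these form a subgroup $\mathrm{PSA}(A_\Gamma)\le\mathrm{Aut}(A_\Gamma)$, and $\mathrm{PSO}(A_\Gamma)$ denotes its image in $\mathrm{Out}(A_\Gamma)$. *)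

(* Defs.v *)
(* Right-angled Artin groups are encoded by words
   modulo the congruence generated by free cancellation and commutation of
   adjacent letters whose generators are adjacent in the graph.           *)
From Stdlib Require Import Relations.
From mathcomp Require Import all_boot.
Set Implicit Arguments. Unset Strict Implicit. Unset Printing Implicit Defensive.

Definition simple_graph (V : finType) (e : rel V) : Prop :=
  symmetric e /\ irreflexive e.

(* words in V^{+-1}: (v,false) = v, (v,true) = v^-1 *)
Definition word (V : Type) := seq (V * bool).

Definition inv_word (V : Type) (w : word V) : word V :=
  rev (map (fun p => (p.1, ~~ p.2)) w).

Inductive raag_step (V : Type) (e : rel V) : word V -> word V -> Prop :=
| raag_cancel (u v : word V) (x : V) (b : bool) :
    raag_step e (u ++ (x, b) :: (x, ~~ b) :: v) (u ++ v)
| raag_comm (u v : word V) (x y : V) (b c : bool) :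
    e x y -> raag_step e (u ++ (x, b) :: (y, c) :: v) (u ++ (y, c) :: (x, b) :: v).

Definition raag_eq (V : Type) (e : rel V) : Relation_Definitions.relation (word V) :=
  clos_refl_sym_trans _ (raag_step e).

Definition subst (V W : Type) (g : V -> word W) (w : word V) : word W :=
  flatten (map (fun p => if p.2 then inv_word (g p.1) else g p.1) w).

Definition is_hom (V W : Type) (eV : rel V) (eW : rel W) (g : V -> word W) : Prop :=
  forall x y, eV x y -> raag_eq eW (g x ++ g y) (g y ++ g x).

(* automorphisms of A_Gamma, represented by the images of the generators *)
Definition is_aut (V : Type) (e : rel V) (g : V -> word V) : Prop :=
  is_hom e e g /\
  exists h : V -> word V, is_hom e e h /\
    forall v, raag_eq e (subst g (h v)) [:: (v, false)] /\
              raag_eq e (subst h (g v)) [:: (v, false)].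

Definition is_psa (V : Type) (e : rel V) (g : V -> word V) : Prop :=
  is_aut e g /\
  forall v, exists c : word V, raag_eq e (g v) (c ++ (v, false) :: inv_word c).

Definition aut_comp (V : Type) (g1 g2 : V -> word V) : V -> word V :=
  fun v => subst g1 (g2 v).

Definition aut_eq (V : Type) (e : rel V) (g1 g2 : V -> word V) : Prop :=
  forall v, raag_eq e (g1 v) (g2 v).

Definition out_eq (V : Type) (e : rel V) (g1 g2 : V -> word V) : Prop :=
  exists c : word V, forall v, raag_eq e (g1 v) (c ++ g2 v ++ inv_word c).

(* A_Lambda is isomorphic to PSO(A_Gamma) = PSA(A_Gamma)/Inn(A_Gamma)
   (note Inn <= PSA): F is a map from words of Lambda into PSA which induces
   a well-defined, injective, surjective homomorphism A_Lambda -> PSO. *)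
Definition raag_iso_PSO (L V : Type) (eL : rel L) (e : rel V) : Prop :=
  exists F : word L -> (V -> word V),
    (forall w, is_psa e (F w)) /\
    (forall w1 w2, out_eq e (F (w1 ++ w2)) (aut_comp (F w1) (F w2))) /\
    (forall w1 w2, raag_eq eL w1 w2 <-> out_eq e (F w1) (F w2)) /\
    (forall g, is_psa e g -> exists w, out_eq e g (F w)).

(* PSO has finite index in Out, i.e. (since Inn <= PSA) PSA has finite index
   in Aut: finitely many automorphisms s i whose left cosets cover Aut. *)
Definition PSO_finite_index (V : Type) (e : rel V) : Prop :=
  exists (m : nat) (s : 'I_m -> V -> word V),
    (forall i, is_aut e (s i)) /\
    forall g, is_aut e g ->
      exists i p, is_psa e p /\ aut_eq e g (aut_comp (s i) p).

Definition rigid_graph (V : finType) (e : rel V) : Prop :=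
  forall s : V -> V, bijective s -> (forall a b, e (s a) (s b) = e a b) ->
    forall x, s x = x.

(* Main.v *)
(* A letter [a] determines the hyperplane of the Cayley graph of the group dual to the
   edge from [1] to [a]; [beg a g] says that it separates [1] from [g].  Two arguments on
   hyperplanes carry the proof.

   If [phi] maps every vertex [v] to [c_v v c_v^-1], the cosets [c_v A_st(v)] of adjacent
   vertices meet.  Shifting by a generator [x] the cosets that lie beyond its hyperplane
   shortens the [c_v], and no coset beyond it belongs to a vertex adjacent to one whose
   coset lies before it.  So, in a graph where no link is contained in another star, the
   vertices that move are a union of components of the complement of the star of [x].

   If [phi] is any automorphism of such a graph, the relations
   [g_y h_z = g_z h_y] (y, z not adjacent) between the exponents of commuting elements force
   the matrix of [phi] on the abelianisation to be monomial, hence diagonal when the graph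
   is rigid.  After correcting signs, [phi v] commutes with [phi z], which has exponent [1]
   in [z], for every [z] in the link of [v]; this makes [phi v] conjugate into [A_lk(z)]
   for all these [z], and so conjugate to [v].

   The graph realising [Lambda] contains it in such a way that removing the star of a
   vertex [x] disconnects the graph only for [x] in [Lambda], and then always cuts off the
   same piece [C].  Every pure symmetric automorphism is therefore, up to inner ones, the
   conjugation of [C] by an element of [A_Lambda]. *)
From HB Require Import structures.
From Stdlib Require Import Relations Classical.
Require Import Defs.
From mathcomp Require Import all_boot all_algebra perm zify ring.
Set Implicit Arguments. Unset Strict Implicit. Unset Printing Implicit Defensive.


(** * Words and normal forms *)

Structure sgraph := SGraph {
  svert :> finType;
  adj : rel svert;
  adj_sym : symmetric adj;
  adj_irr : irreflexive adj }.

Section Words.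
Variable V : sgraph.
Local Notation e := (@adj V).
Local Notation letter := (V * bool)%type.
Implicit Types (a b c d : letter) (u v w : seq letter) (x y z : V).

Definition linv a : letter := (a.1, ~~ a.2).

Lemma linvK : involutive linv.
Proof. by case=> x b; rewrite /linv negbK. Qed.

Lemma linv_neq a : (linv a == a) = false.
Proof. by case: a => x [] ; apply/eqP => -[]. Qed.

Lemma adj_neq x y : e x y -> x != y.
Proof. by apply: contraL => /eqP->; rewrite adj_irr. Qed.

Lemma adj_letter_neq a b : e a.1 b.1 -> (a == b) = false.
Proof. by move/adj_neq; apply: contraNF => /eqP->. Qed.

Fixpoint del a w : option (seq letter) :=
  if w is c :: w' then
    if c == a then Some w' else
    if e a.1 c.1 then omap (cons c) (del a w') else None
  else None.

Definition wbeg a w : bool := isSome (del a w).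

Definition push a w := if del (linv a) w is Some w' then w' else a :: w.

Definition nf w := foldr push [::] w.

Fixpoint red w : bool := if w is a :: w' then ~~ wbeg (linv a) w' && red w' else true.

Definition proj x y w := [seq c <- w | (c.1 == x) || (c.1 == y)].

(* Words with the same projections to all pairs of non-adjacent vertices are exactly
   those that differ by commutations; the pairs include [x = y]. *)
Definition pe : rel (seq letter) :=
  fun w1 w2 => [forall x, forall y, ~~ e x y ==> (proj x y w1 == proj x y w2)].

Lemma peP w1 w2 :
  reflect (forall x y, ~~ e x y -> proj x y w1 = proj x y w2) (pe w1 w2).
Proof.
apply: (iffP forallP) => [H x y nxy | H x].
  by have /forallP/(_ y)/implyP/(_ nxy)/eqP := H x.
by apply/forallP => y; apply/implyP => nxy; apply/eqP/H.
Qed.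

Lemma pe_refl : reflexive pe.
Proof. by move=> w; apply/peP. Qed.

Lemma pe_sym : symmetric pe.
Proof. by move=> u v; apply/peP/peP => H x y nxy; rewrite H. Qed.

Lemma pe_trans : transitive pe.
Proof. by move=> v u w /peP H1 /peP H2; apply/peP => x y nxy; rewrite H1 ?H2. Qed.

Lemma pe_cons a u v : pe (a :: u) (a :: v) = pe u v.
Proof.
apply/peP/peP => H x y nxy; have := H x y nxy => /=; first by case: ifP => // _ [].
by move=> ->.
Qed.

Lemma pe_rev u v : pe u v -> pe (rev u) (rev v).
Proof. by move=> /peP H; apply/peP => x y nxy; rewrite /proj !filter_rev -!/(proj _ _ _) H. Qed.

Lemma pe_swap a b w : e a.1 b.1 -> pe (a :: b :: w) (b :: a :: w).
Proof.
move=> ab; apply/peP => x y nxy /=.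
case: ifP => [/orP[]/eqP ax|_]; case: ifP => [/orP[]/eqP bx|_] //.
- by rewrite ax bx adj_irr in ab.
- by rewrite ax bx (negPf nxy) in ab.
- by rewrite ax bx adj_sym (negPf nxy) in ab.
- by rewrite ax bx adj_irr in ab.
Qed.

Lemma wbeg_cons a c w : wbeg a (c :: w) = (c == a) || (e a.1 c.1 && wbeg a w).
Proof.
rewrite /wbeg /=; case: ifP => //= _; case: ifP => //= _.
by case: (del a w).
Qed.

Lemma wbegP a w : reflect (exists m q, w = m ++ a :: q /\ all (fun c => e a.1 c.1) m) (wbeg a w).
Proof.
elim: w => [|c w IH]; first by constructor; case=> -[|? ?] [? []].
rewrite wbeg_cons; case: eqP => [->|ca] /=; first by constructor; exists [::], w.
case: (boolP (e _ _)) => [ac|nac] /=.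
  apply: (iffP IH) => [[m [q [-> am]]]|]; first by exists (c :: m), q; rewrite /= ac.
  case=> -[|c' m] [q [] /= []]; first by move=> /ca.
  by move=> <- -> /andP[_ am]; exists m, q.
constructor => -[[|c' m] [q [] /= []]]; first by move=> /ca.
by move=> <- _; rewrite (negPf nac).
Qed.

Lemma del_pe a w w' : del a w = Some w' -> pe w (a :: w').
Proof.
elim: w w' => //= c w IH w'; case: eqP => [-> [->]|_]; first exact: pe_refl.
case: ifP => // ac; case Ed: del => [w2|] //= [<-].
apply: (@pe_trans (c :: a :: w2)); first by rewrite pe_cons; apply: IH.
by apply: pe_swap; rewrite adj_sym.
Qed.

(** The first letter of [w] that could block [a] has a vertex not adjacent to [a.1], and the
    projection to that pair of vertices would show it in front of [a]. *)
Lemma wbeg_proj a w :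
  (forall y, ~~ e a.1 y -> exists t, proj a.1 y w = a :: t) -> wbeg a w.
Proof.
elim: w => [|c w IH] H; first by have [|t] := H a.1; rewrite ?adj_irr.
rewrite wbeg_cons; case: eqP => //= ca; case: (boolP (e _ _)) => [ac|nac] /=.
  apply: IH => y nay; have [t] := H y nay; rewrite /= (_ : _ || _ = false); first by exists t.
  apply/negbTE/norP; split; first by rewrite eq_sym; apply: adj_neq.
  by apply: contraNneq nay => <-.
by have [t] := H _ nac; rewrite /= eqxx orbT => -[].
Qed.

(** Peeling off a first letter is the induction step for all statements about words up to
    commutation. *)
Lemma pe_del a u w : pe (a :: u) w -> exists2 w', del a w = Some w' & pe u w'.
Proof.
move=> P; have : wbeg a w.
  apply: wbeg_proj => y nay; move/peP/(_ _ _ nay): P => <- /=.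
  by rewrite eqxx /=; eexists.
rewrite /wbeg; case Ed: del => [w'|] // _; exists w' => //.
by rewrite -(pe_cons a); apply: pe_trans P (del_pe Ed).
Qed.

Lemma pe_del2 a w1 w2 w1' : pe w1 w2 -> del a w1 = Some w1' ->
  exists2 w2', del a w2 = Some w2' & pe w1' w2'.
Proof.
move=> P /del_pe D; apply: pe_del; apply: pe_trans P.
by rewrite pe_sym.
Qed.

Lemma pe_wbeg a w1 w2 : pe w1 w2 -> wbeg a w1 = wbeg a w2.
Proof.
have H w w' : pe w w' -> wbeg a w -> wbeg a w'.
  by move=> P; rewrite /wbeg; case Ed: del => // _; have [? ->] := pe_del2 P Ed.
by move=> P; apply/idP/idP; apply: H; rewrite // pe_sym.
Qed.

Lemma pe_push a w1 w2 : pe w1 w2 -> pe (push a w1) (push a w2).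
Proof.
move=> P; rewrite /push; case Ed: del => [w'|].
  by have [w2' -> P'] := pe_del2 P Ed.
have := pe_wbeg (linv a) P; rewrite /wbeg Ed; case: del => // _.
by rewrite pe_cons.
Qed.

Lemma red_del a w w' : del a w = Some w' -> red w' -> ~~ wbeg (linv a) w' -> red w.
Proof.
elim: w w' => //= c w IH w'; case: eqP => [-> [->] -> ->|ca] //.
case: ifP => // ac; case Ed: del => [w2|] //= [<-] /= /andP[nc r2].
have ca' : e c.1 a.1 by rewrite adj_sym.
rewrite wbeg_cons adj_letter_neq //= ac /= => na.
rewrite (IH _ Ed) // andbT (pe_wbeg _ (del_pe Ed)) wbeg_cons adj_letter_neq //=.
by rewrite (negPf nc) andbF.
Qed.

Lemma pe_red w1 w2 : pe w1 w2 -> red w1 = red w2.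
Proof.
have H w w' : pe w w' -> red w -> red w'.
  elim: w w' => [|a u IH] w' P /=.
    case: w' P => // c w' /peP/(_ c.1 c.1); rewrite adj_irr /= eqxx => H _.
    by have := H isT.
  case/andP=> na ru; have [w2' D P'] := pe_del P.
  by apply: (red_del D); rewrite ?(IH _ P') // -(pe_wbeg _ P').
by move=> P; apply/idP/idP; apply: H; rewrite // pe_sym.
Qed.

Lemma red_push a w : red w -> red (push a w).
Proof.
move=> r; rewrite /push; case Ed: del => [w'|] /=.
  by move: r; rewrite (pe_red (del_pe Ed)) /= => /andP[].
by rewrite r /wbeg Ed.
Qed.

Lemma push_red a w : red (a :: w) -> push a w = a :: w.
Proof. by rewrite /= /push /wbeg => /andP[]; case: del. Qed.

Lemma push_linv a w : red w -> pe (push a (push (linv a) w)) w.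
Proof.
move=> r; rewrite {2}/push linvK; case Ed: del => [w'|].
  have P := del_pe Ed; rewrite push_red; first by rewrite pe_sym.
  by rewrite -(pe_red P).
by rewrite /push /= eqxx pe_refl.
Qed.

Lemma push_comm a b w : e a.1 b.1 -> pe (push a (push b w)) (push b (push a w)).
Proof.
move=> ab; have ba : e b.1 a.1 by rewrite adj_sym.
have nab : (linv a == b) = false by apply: adj_letter_neq.
have nba : (linv b == a) = false by apply: adj_letter_neq.
have nab' : (b == linv a) = false by rewrite eq_sym.
have nba' : (a == linv b) = false by rewrite eq_sym.
rewrite {2 4}/push; case Eb: (del (linv b) w) => [wb|]; case Ea: (del (linv a) w) => [wa|].
- have [Pa Pb] := (del_pe Ea, del_pe Eb).
  have Ba : wbeg (linv a) wb.
    have : wbeg (linv a) w by rewrite /wbeg Ea.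
    by rewrite (pe_wbeg _ Pb) wbeg_cons adj_letter_neq // => /andP[].
  have Bb : wbeg (linv b) wa.
    have : wbeg (linv b) w by rewrite /wbeg Eb.
    by rewrite (pe_wbeg _ Pa) wbeg_cons adj_letter_neq // => /andP[].
  move: Ba Bb; rewrite /push /wbeg.
  case Eab: del => [wab|] // _; case Eba: del => [wba|] // _.
  rewrite -(pe_cons (linv b)) -(pe_cons (linv a)).
  apply: (@pe_trans w).
    apply: (@pe_trans (linv b :: linv a :: wab)); first exact: pe_swap.
    rewrite pe_sym; apply: pe_trans Pb _; rewrite pe_cons; exact: del_pe.
  by apply: pe_trans Pa _; rewrite pe_cons; exact: del_pe.
- have : ~~ wbeg (linv a) wb.
    have : ~~ wbeg (linv a) w by rewrite /wbeg Ea.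
    by rewrite (pe_wbeg _ (del_pe Eb)) wbeg_cons adj_letter_neq //= ab.
  rewrite /push /wbeg; case: del => // _ /=.
  by rewrite nba' ba Eb /= pe_refl.
- have : ~~ wbeg (linv b) wa.
    have : ~~ wbeg (linv b) w by rewrite /wbeg Eb.
    by rewrite (pe_wbeg _ (del_pe Ea)) wbeg_cons adj_letter_neq //= ba.
  rewrite /push /wbeg; case Ed: (del _ wa) => // _ /=.
  by rewrite nab' ab Ea /= pe_refl.
- by rewrite /push /= nab' nba' ab ba Ea Eb /=; apply: pe_swap.
Qed.

Lemma red_nf w : red (nf w).
Proof. by elim: w => //= a w; apply: red_push. Qed.

Lemma nf_red w : red w -> nf w = w.
Proof. by elim: w => //= a w IH r; have /andP[_ /IH->] := r; rewrite push_red. Qed.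

Lemma foldr_push_pe u w1 w2 : pe w1 w2 -> pe (foldr push w1 u) (foldr push w2 u).
Proof. by move=> P; elim: u => //= a u; apply: pe_push. Qed.

(** The van der Waerden argument: [push] lets letters act on reduced words modulo [pe]. Inverse
    letters act inversely by [push_linv] and adjacent ones commute by [push_comm], so the defining
    relations act trivially. *)
Lemma raag_eq_nf w1 w2 : raag_eq e w1 w2 -> pe (nf w1) (nf w2).
Proof.
elim=> [? ? [u v x b|u v x y b c xy]|w|u v _ IH|u v w _ IH1 _ IH2].
- rewrite /nf !foldr_cat; apply: foldr_push_pe => /=.
  by have := push_linv (x, b) (red_nf v); apply.
- by rewrite /nf !foldr_cat; apply: foldr_push_pe => /=; apply: push_comm.
- exact: pe_refl.
- by rewrite pe_sym.
- exact: pe_trans IH1 IH2.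
Qed.

Lemma raag_eq_refl w : raag_eq e w w.
Proof. exact: rst_refl. Qed.

Lemma raag_eq_sym w1 w2 : raag_eq e w1 w2 -> raag_eq e w2 w1.
Proof. exact: rst_sym. Qed.

Lemma raag_eq_trans w2 w1 w3 : raag_eq e w1 w2 -> raag_eq e w2 w3 -> raag_eq e w1 w3.
Proof. exact: rst_trans. Qed.

Lemma raag_eq_catl u w1 w2 : raag_eq e w1 w2 -> raag_eq e (u ++ w1) (u ++ w2).
Proof.
elim=> [? ? [p v x b|p v x y b c xy]|w|p v _ IH|p v w _ IH1 _ IH2].
- by rewrite !catA; apply/rst_step/raag_cancel.
- by rewrite !catA; apply/rst_step/raag_comm.
- exact: rst_refl.
- exact: rst_sym.
- exact: rst_trans IH1 IH2.
Qed.

Lemma raag_eq_catr u w1 w2 : raag_eq e w1 w2 -> raag_eq e (w1 ++ u) (w2 ++ u).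
Proof.
elim=> [? ? [p v x b|p v x y b c xy]|w|p v _ IH|p v w _ IH1 _ IH2].
- by rewrite -!catA; apply/rst_step/raag_cancel.
- by rewrite -!catA; apply/rst_step/raag_comm.
- exact: rst_refl.
- exact: rst_sym.
- exact: rst_trans IH1 IH2.
Qed.

Lemma raag_eq_cat u u' v v' :
  raag_eq e u u' -> raag_eq e v v' -> raag_eq e (u ++ v) (u' ++ v').
Proof. by move=> /(raag_eq_catr v) H1 /(raag_eq_catl u'); apply: raag_eq_trans. Qed.

Lemma del_raag_eq a w w' : del a w = Some w' -> raag_eq e w (a :: w').
Proof.
elim: w w' => //= c w IH w'; case: eqP => [-> [->]|_]; first exact: raag_eq_refl.
case: ifP => // ac; case Ed: del => [w2|] //= [<-].
apply: (raag_eq_trans (raag_eq_catl [:: c] (IH _ Ed))) => /=.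
case: c a ac {IH Ed} => x b [y c] /= yx.
by apply/rst_step/(@raag_comm _ _ [::]); rewrite adj_sym.
Qed.

Lemma pe_raag_eq w1 w2 : pe w1 w2 -> raag_eq e w1 w2.
Proof.
elim: w1 w2 => [|a u IH] w P.
  case: w P => [_|c w /peP/(_ c.1 c.1)]; first exact: raag_eq_refl.
  by rewrite adj_irr /= eqxx => /(_ isT).
have [w' D /IH P'] := pe_del P.
apply: raag_eq_trans (raag_eq_catl [:: a] P') _.
exact/raag_eq_sym/del_raag_eq.
Qed.

Lemma raag_eq_linv a w : raag_eq e (a :: linv a :: w) w.
Proof. by case: a => x b; apply/rst_step/(raag_cancel _ [::]). Qed.

Lemma nf_raag_eq w : raag_eq e w (nf w).
Proof.
elim: w => [|a w IH] /=; first exact: raag_eq_refl.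
apply: raag_eq_trans (raag_eq_catl [:: a] IH) _; rewrite /push.
case Ed: del => [w'|]; last exact: raag_eq_refl.
apply: raag_eq_trans (raag_eq_catl [:: a] (del_raag_eq Ed)) _.
exact: raag_eq_linv.
Qed.

Lemma raag_eqP w1 w2 : raag_eq e w1 w2 <-> pe (nf w1) (nf w2).
Proof.
split=> [|/pe_raag_eq H]; first exact: raag_eq_nf.
exact: raag_eq_trans (nf_raag_eq w1) (raag_eq_trans H (raag_eq_sym (nf_raag_eq w2))).
Qed.

Lemma del_perm a w w' : del a w = Some w' -> perm_eq w (a :: w').
Proof.
elim: w w' => //= c w IH w'; case: eqP => [-> [->]|_] //.
case: ifP => // ac; case Ed: del => [w2|] //= [<-].
rewrite (@perm_trans _ (c :: a :: w2)) ?perm_cons ?IH //.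
exact/permPl/(perm_catCA [:: c] [:: a]).
Qed.

Lemma pe_perm w1 w2 : pe w1 w2 -> perm_eq w1 w2.
Proof.
elim: w1 w2 => [|a u IH] w P.
  by case: w P => // c w /peP/(_ c.1 c.1); rewrite adj_irr /= eqxx => /(_ isT).
have [w' D /IH P'] := pe_del P.
by rewrite perm_sym (perm_trans (del_perm D)) // perm_cons perm_sym.
Qed.

Lemma push_all (T : pred letter) a w : T a -> all T w -> all T (push a w).
Proof.
move=> Ta Tw; rewrite /push; case Ed: del => [w'|] /=; last by rewrite Ta.
by move: Tw; rewrite (perm_all _ (del_perm Ed)) => /andP[].
Qed.

Lemma nf_all (T : pred letter) w : all T w -> all T (nf w).
Proof. by elim: w => //= a w IH /andP[Ta /IH]; apply: push_all. Qed.

(** Unlike the recursive definition, this description is symmetric under reversal, which gives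
    [red_rev] and with it all facts on right multiplication. *)
Lemma redP w :
  reflect (forall p a m q, w = p ++ a :: m ++ linv a :: q -> ~~ all (fun c => e a.1 c.1) m)
          (red w).
Proof.
elim: w => [|c w IH] /=; first by constructor=> -[].
apply: (iffP andP) => [[/wbegP nc /IH H] [|c' p] a m q /= []|H].
- move=> ca wE; apply/negP => am; apply: nc.
  by rewrite wE ca; exists m, q.
- by move=> _; apply: H.
- split; last by apply/IH => p a m q wE; apply: (H (c :: p) a m q); rewrite wE.
  apply/negP => /wbegP [m [q [wE am]]].
  by have := H [::] c m q; rewrite wE am => /(_ erefl).
Qed.

Lemma red_rev w : red (rev w) = red w.
Proof.
suff H u : red u -> red (rev u) by apply/idP/idP => [/H|/H //]; rewrite revK.
move/redP=> H; apply/redP => p a m q /(congr1 rev).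
rewrite revK !(rev_cat, rev_cons) -!cats1 -!catA /= => uE.
have /= := H (rev q) (linv a) (rev m) (rev p); rewrite linvK all_rev.
by apply; rewrite uE.
Qed.

Lemma wbeg_rcons a w d : wbeg a (rcons w d) -> wbeg a w \/ (d = a /\ all (fun c => e a.1 c.1) w).
Proof.
elim: w => [|c w IH] /=; first by rewrite wbeg_cons /wbeg /= andbF orbF => /eqP->; right.
rewrite !wbeg_cons => /orP[->|/andP[-> /IH[->|[-> ->]]]]; first by left.
  by left; rewrite orbT.
by right.
Qed.

Lemma wbeg_rcons_mono a w d : wbeg a w -> wbeg a (rcons w d).
Proof.
case/wbegP=> m [q [-> am]]; apply/wbegP; exists m, (rcons q d); split=> //.
by rewrite rcons_cat.
Qed.

Lemma red_rcons_case w b : red w ->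
  red (rcons w b) \/ exists2 w', red (rcons w' (linv b)) & pe w (rcons w' (linv b)).
Proof.
move=> r; case Eb: (del (linv b) (rev w)) => [w'|]; [right|left].
  have P := pe_rev (del_pe Eb); move: P; rewrite revK rev_cons => P.
  by exists (rev w'); rewrite // -(pe_red P).
by rewrite -red_rev rev_rcons /= red_rev r andbT /wbeg Eb.
Qed.

End Words.


(** * The group and its hyperplanes *)

Section RaagGroup.
Variable V : sgraph.
Local Notation e := (@adj V).
Local Notation letter := (V * bool)%type.
Implicit Types (a b c d : letter) (u v w : seq letter) (x y z : V).

(** The boolean form of [raag_eq], from which the group is built as a quotient type. *)
Definition raag_eqb : rel (seq letter) := fun w1 w2 => pe (nf w1) (nf w2).

Lemma raag_eqb_refl : reflexive raag_eqb.
Proof. by move=> w; apply: pe_refl. Qed.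
Lemma raag_eqb_sym : symmetric raag_eqb.
Proof. by move=> u v; apply: pe_sym. Qed.
Lemma raag_eqb_trans : transitive raag_eqb.
Proof. by move=> v u w; apply: pe_trans. Qed.

Canonical raag_equiv := EquivRel raag_eqb raag_eqb_refl raag_eqb_sym raag_eqb_trans.

Definition raag := {eq_quot raag_eqb}%qT.
HB.instance Definition _ := Choice.on raag.
HB.instance Definition _ := Quotient.on raag.

Definition el w : raag := \pi_raag%qT w.

Lemma elP w1 w2 : el w1 = el w2 <-> raag_eq e w1 w2.
Proof.
split=> [/eqP|/raag_eqP H].
  by rewrite /el eqmodE => /raag_eqP.
by apply/eqP; rewrite /el eqmodE.
Qed.

Lemma raag_eq_linvl a w : raag_eq e (linv a :: a :: w) w.
Proof. by have := raag_eq_linv (linv a) w; rewrite linvK. Qed.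

Lemma inv_word_cons a w : inv_word (a :: w) = rcons (inv_word w) (linv a).
Proof. by rewrite /inv_word /= rev_cons. Qed.

Lemma inv_word_rcons a w : inv_word (rcons w a) = linv a :: inv_word w.
Proof. by rewrite /inv_word map_rcons rev_rcons. Qed.

Lemma inv_wordK : involutive (@inv_word V).
Proof.
elim/last_ind=> // w a IH.
by rewrite inv_word_rcons inv_word_cons IH linvK.
Qed.

Lemma raag_eq_inv_wordl w : raag_eq e (inv_word w ++ w) [::].
Proof.
elim: w => [|a w IH]; first exact: raag_eq_refl.
rewrite inv_word_cons cat_rcons; apply: raag_eq_trans IH.
exact/raag_eq_catl/raag_eq_linvl.
Qed.

Lemma raag_eq_inv_wordr w : raag_eq e (w ++ inv_word w) [::].
Proof. by have := raag_eq_inv_wordl (inv_word w); rewrite inv_wordK. Qed.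

Lemma el_repr (g : raag) : el (repr g) = g.
Proof. exact: reprK. Qed.

Definition rmul (g h : raag) : raag := el (repr g ++ repr h).
Definition rinv (g : raag) : raag := el (inv_word (repr g)).
Definition rone : raag := el [::].

Lemma rmul_el u v : rmul (el u) (el v) = el (u ++ v).
Proof. by apply/elP/raag_eq_cat; apply/elP; rewrite el_repr. Qed.

Fact rmulA : associative rmul.
Proof.
move=> g h k; rewrite -(el_repr g) -(el_repr h) -(el_repr k).
by rewrite !rmul_el catA.
Qed.
Fact rmul1g : left_id rone rmul.
Proof. by move=> g; rewrite -(el_repr g) rmul_el. Qed.
Fact rmulg1 : right_id rone rmul.
Proof. by move=> g; rewrite -(el_repr g) rmul_el cats0. Qed.
Fact rmulVg : left_inverse rone rinv rmul.
Proof.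
by move=> g; rewrite -{2}(el_repr g) rmul_el; apply/elP/raag_eq_inv_wordl.
Qed.
Fact rmulgV : right_inverse rone rinv rmul.
Proof.
by move=> g; rewrite -{1}(el_repr g) rmul_el; apply/elP/raag_eq_inv_wordr.
Qed.

HB.instance Definition _ := isGroup.Build raag rmulA rmul1g rmulg1 rmulVg rmulgV.

End RaagGroup.


(** * Word length, half-spaces and special subgroups *)

Section RaagGeometry.
Variable V : sgraph.
Local Notation e := (@adj V).
Local Notation letter := (V * bool)%type.
Local Notation G := (raag V).
Implicit Types (a b c d : letter) (u v w : seq letter) (x y z : V) (g h k : G).
Local Open Scope group_scope.

Lemma el_nil : el [::] = 1 :> G. Proof. by []. Qed.

Lemma el_cat u v : el (u ++ v) = el u * el v :> G.
Proof. exact/esym/rmul_el. Qed.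

Definition gl a : G := el [:: a].

Lemma el_cons a w : el (a :: w) = gl a * el w :> G.
Proof. exact: (el_cat [:: a]). Qed.

Lemma el_rcons a w : el (rcons w a) = el w * gl a :> G.
Proof. by rewrite -cats1 el_cat. Qed.

Lemma el_inv w : el (inv_word w) = (el w)^-1 :> G.
Proof.
apply: (mulgI (el w)); rewrite mulgV -el_cat.
exact/elP/raag_eq_inv_wordr.
Qed.

Lemma gl_linv a : gl (linv a) = (gl a)^-1.
Proof. by rewrite -el_inv. Qed.

Lemma gl_comm a b : e a.1 b.1 -> commute (gl a) (gl b).
Proof.
case: a b => x b [y c] xy; rewrite /commute -!el_cat.
by apply/elP/rst_step/(raag_comm [::] [::]).
Qed.

(** A chosen reduced word. By [red_pe] any other one agrees with it up to commutations, so length,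
    initial letters and support do not depend on the choice. *)
Definition wd g := nf (repr g).

Lemma red_wd g : red (wd g). Proof. exact: red_nf. Qed.

Lemma wdK g : el (wd g) = g.
Proof.
rewrite -[RHS]el_repr; apply/elP/raag_eq_sym/nf_raag_eq.
Qed.

Lemma wd_el w : pe (wd (el w)) (nf w).
Proof. by apply/raag_eqP/elP; rewrite el_repr. Qed.

Lemma wd_red w : red w -> pe (wd (el w)) w.
Proof. by move=> r; have := wd_el w; rewrite nf_red. Qed.

Lemma red_pe u v : red u -> red v -> el u = el v -> pe u v.
Proof.
move=> ru rv uv; rewrite (pe_trans _ (wd_red rv)) // pe_sym -uv.
exact: wd_red.
Qed.

Definition len g := size (wd g).
Definition beg a g := wbeg a (wd g).

Lemma len_red w : red w -> len (el w) = size w.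
Proof. by move/wd_red/pe_perm/perm_size. Qed.

Lemma beg_red a w : red w -> beg a (el w) = wbeg a w.
Proof. by move/wd_red => P; apply: pe_wbeg. Qed.

Lemma len0 g : len g = 0 -> g = 1.
Proof. by rewrite -{2}(wdK g) => /eqP; rewrite /len size_eq0 => /eqP->. Qed.

Lemma beg1 a : beg a 1 = false.
Proof. by rewrite -el_nil beg_red. Qed.

Lemma beg_ex g : g != 1 -> exists a, beg a g.
Proof.
move=> g1; case E: (wd g) => [|a w]; first by rewrite -(wdK g) E eqxx in g1.
by exists a; rewrite /beg E wbeg_cons eqxx.
Qed.

Lemma beg_split a g : beg a g -> exists2 w, red (a :: w) & g = el (a :: w).
Proof.
rewrite /beg /wbeg; case E: del => [w|] // _; exists w.
  by rewrite -(pe_red (del_pe E)) red_wd.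
by rewrite -{1}(wdK g); apply/elP/pe_raag_eq/del_pe.
Qed.

Lemma len_beg a g : beg a g -> (len (gl (linv a) * g)).+1 = len g.
Proof.
case/beg_split=> w r ->; rewrite el_cons gl_linv mulKg -el_cons !len_red //.
by case/andP: r.
Qed.

Lemma nbeg_split a g : ~~ beg a g -> red (linv a :: wd g).
Proof. by rewrite /beg /= linvK red_wd andbT. Qed.

Lemma len_nbeg a g : ~~ beg a g -> len (gl (linv a) * g) = (len g).+1.
Proof. by move/nbeg_split=> r; rewrite -{1}(wdK g) -el_cons len_red. Qed.

Lemma len_gl_mul a g : len (gl a * g) <= (len g).+1.
Proof.
rewrite -(linvK a); case: (boolP (beg (linv a) g)) => [/len_beg|/len_nbeg->] //; lia.
Qed.

Lemma begM a g : beg a (gl a * g) = ~~ beg (linv a) g.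
Proof.
case: (boolP (beg (linv a) g)) => B /=.
  have [w r ->] := beg_split B; rewrite el_cons gl_linv mulVKg.
  have /= /andP[na rw] := r; rewrite linvK in na.
  by rewrite beg_red ?(negPf na).
have := nbeg_split B; rewrite linvK => r.
by rewrite -(wdK g) -el_cons beg_red // wbeg_cons eqxx.
Qed.

Lemma beg2_adj a b g : beg a g -> beg b g -> a != b -> e a.1 b.1.
Proof.
case/beg_split=> w r ->; rewrite beg_red // wbeg_cons => /orP[/eqP->|/andP[]].
  by rewrite eqxx.
by rewrite adj_sym.
Qed.

(** The special subgroup generated by [T]. Testing one reduced word suffices because normalising a
    word introduces no letters ([nf_all]). *)
Definition sgp (T : {pred V}) : {pred G} := [pred g | all (fun c => c.1 \in T) (wd g)].

Lemma el_sgp (T : {pred V}) w : all (fun c => c.1 \in T) w -> el w \in sgp T.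
Proof. by move=> Tw; rewrite inE (perm_all _ (pe_perm (wd_el w))) nf_all. Qed.

Lemma red_sgp (T : {pred V}) w : red w -> (el w \in sgp T) = all (fun c => c.1 \in T) w.
Proof. by move=> r; rewrite inE (perm_all _ (pe_perm (wd_red r))). Qed.

Lemma sgp1 (T : {pred V}) : 1 \in sgp T.
Proof. exact: (@el_sgp T [::]). Qed.

Lemma sgpM (T : {pred V}) g h : g \in sgp T -> h \in sgp T -> g * h \in sgp T.
Proof.
rewrite !inE => Tg Th; rewrite -(wdK g) -(wdK h) -el_cat.
by apply: el_sgp; rewrite all_cat Tg.
Qed.

Lemma sgpV (T : {pred V}) g : g \in sgp T -> g^-1 \in sgp T.
Proof.
rewrite inE => Tg; rewrite -(wdK g) -el_inv; apply: el_sgp.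
by rewrite /inv_word all_rev all_map.
Qed.

Lemma sgpS (T T' : {pred V}) g : {subset T <= T'} -> g \in sgp T -> g \in sgp T'.
Proof. by move=> sT; apply: sub_all => c /sT. Qed.

Lemma gl_sgp (T : {pred V}) a : (gl a \in sgp T) = (a.1 \in T).
Proof. by rewrite red_sgp //= andbT. Qed.

Definition lk x : {pred V} := [pred y | e x y].
Definition st x : {pred V} := [pred y | (y == x) || e x y].

Lemma st_refl x : x \in st x. Proof. by rewrite inE eqxx. Qed.
Lemma st_sym x y : (x \in st y) = (y \in st x).
Proof. by rewrite !inE eq_sym adj_sym. Qed.
Lemma lk_st x : {subset lk x <= st x}.
Proof. by move=> y; rewrite !inE => ->; rewrite orbT. Qed.

Lemma sgp_st_comm a g : g \in sgp (st a.1) -> commute (gl a) g.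
Proof.
rewrite inE -{2}(wdK g); elim: (wd g) => [_|c w IH] /=; first exact: commute1.
case/andP=> ac /IH aw; rewrite el_cons; apply: commuteM => //.
move: ac; rewrite inE => /orP[/eqP ca|]; last exact: gl_comm.
case: a c ca {IH aw} => x b [y c] /= ->.
have E : gl (x, true) = (gl (x, false))^-1 by rewrite -gl_linv.
by case: b; case: c; rewrite /commute ?E ?mulVg ?mulgV.
Qed.

(* The edge from [g] to [g * gl b] of the Cayley graph leaves or enters the
   half-space [beg a] only if it is dual to the hyperplane of the edge from
   [1] to [gl a]. *)
Lemma beg_mulr a b g : beg a (g * gl b) != beg a g ->
  (b = a /\ g \in sgp (lk a.1)) \/ (b = linv a /\ g * gl b \in sgp (lk a.1)).
Proof.
have [r|[w' r P]] := red_rcons_case b (red_wd g); set w := wd g in r *.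
  rewrite -(wdK g) -el_rcons !beg_red ?red_wd // => N; left.
  have B : wbeg a (rcons (wd g) b).
    by apply: contraR N => nB; rewrite (negPf nB) eq_sym eqbF_neg;
       apply: contra nB; apply: wbeg_rcons_mono.
  have [B'|[-> all_lk]] := wbeg_rcons B; first by rewrite B B' in N.
  by rewrite red_sgp ?red_wd.
have gE : g = el (rcons w' (linv b)) by rewrite -(wdK g); apply/elP/pe_raag_eq.
have rw' : red w' by move: r; rewrite -red_rev rev_rcons /= red_rev => /andP[].
rewrite gE el_rcons gl_linv mulgVK -gl_linv -el_rcons !beg_red // => N; right.
have B : wbeg a (rcons w' (linv b)).
  by apply: contraR N => nB; rewrite (negPf nB) eqbF_neg;
     apply: contra nB; apply: wbeg_rcons_mono.
have [B'|[<- all_lk]] := wbeg_rcons B; first by rewrite B B' in N.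
by rewrite linvK red_sgp.
Qed.

(** A path from [g] to [g * t] inside the coset of [sgp T] has an edge crossing the hyperplane of
    [a]. By [beg_mulr] this edge is labelled by [a] or its inverse and has an endpoint [l] in the
    link subgroup. *)
Lemma coset_cross (T : {pred V}) a g t : t \in sgp T -> beg a (g * t) != beg a g ->
  a.1 \in T /\ exists2 l, l \in sgp (lk a.1) & g^-1 * l \in sgp T.
Proof.
rewrite inE -{2}(wdK t); elim: (wd t) g => [|b w IH] g /=; first by rewrite el_nil mulg1 eqxx.
case/andP=> Tb Tw; rewrite el_cons mulgA => N.
have glT : gl b \in sgp T by rewrite gl_sgp.
case: (eqVneq (beg a (g * gl b)) (beg a g)) => [E|/beg_mulr[[ba lg]|[ba lg]]].
- have [|Ta [l ll H]] := IH (g * gl b) Tw; first by rewrite E.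
  split=> //; exists l => //; rewrite -(mulVKg (gl b) (g^-1 * l)) sgpM //.
  by rewrite mulgA -invgM.
- by split; [rewrite -ba | exists g; rewrite // mulVg sgp1].
- split; first by rewrite -(linvK a) -ba.
  by exists (g * gl b); rewrite // mulKg.
Qed.

Lemma ex_min_len (P : G -> Prop) g : P g -> exists2 h, P h & forall k, P k -> len h <= len k.
Proof.
have [n] := ubnP (len g); elim: n g => // n IH g gn Pg.
case: (classic (exists2 k, P k & len k < len g)) => [[k Pk kg]|N].
  by apply: (IH k) => //; apply: leq_trans kg _.
exists g => // k Pk; rewrite leqNgt; apply/negP => kg; apply: N.
by exists k.
Qed.

Definition min_coset (T : {pred V}) g := forall t, t \in sgp T -> len g <= len (g * t).

(** If the coset crossed the hyperplane of [a], it would contain an element [l] commuting with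
    [gl a], and [a.1] would lie in [T]. Then left multiplication by [gl (linv a)] would preserve the
    coset and shorten its minimal element [g]. *)
Lemma min_coset_beg (T : {pred V}) a g t :
  min_coset T g -> beg a g -> t \in sgp T -> beg a (g * t).
Proof.
move=> mg ag tT; apply/negP => /negP nB.
have [|Ta [l ll lT]] := @coset_cross T a g t tT; first by rewrite ag (negPf nB).
have C : commute (gl (linv a)) l by apply: sgp_st_comm; apply: sgpS ll; apply: lk_st.
have lE : l = g * (g^-1 * l) by rewrite mulVKg.
move: (g^-1 * l) lT lE => q qT lE; rewrite {}lE in ll C.
have /mg : q * gl (linv a) * q^-1 \in sgp T by rewrite !sgpM ?sgpV ?gl_sgp.
by rewrite !mulgA -C -(mulgA _ (g * q)) mulgK -(len_beg ag) ltnn.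
Qed.

End RaagGeometry.


(** * Centralisers *)

Section Centralizers.
Variable V : sgraph.
Local Notation e := (@adj V).
Local Notation letter := (V * bool)%type.
Local Notation G := (raag V).
Implicit Types (a b c d : letter) (u v w : seq letter) (x y z : V) (g h k : G).
Local Open Scope group_scope.

Lemma wbeg_map_linv a w : wbeg (linv a) (map (@linv V) w) = wbeg a w.
Proof.
elim: w => //= c w IH; rewrite !wbeg_cons IH /=.
by rewrite (inj_eq (can_inj (@linvK V))).
Qed.

Lemma red_inv_word w : red (inv_word w) = red w.
Proof.
rewrite /inv_word red_rev; elim: w => //= c w IH.
by rewrite (wbeg_map_linv (linv c)) IH.
Qed.

Lemma lenV g : len g^-1 = len g.
Proof.
rewrite -{1}(wdK g) -el_inv len_red ?red_inv_word ?red_wd //.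
by rewrite /inv_word size_rev size_map.
Qed.

Lemma beg_sgp (T : {pred V}) a g : g \in sgp T -> beg a g -> a.1 \in T.
Proof.
move=> gT /beg_split[w r gE]; move: gT; rewrite gE red_sgp //.
by case/andP.
Qed.

(** The claim says that the double coset of [h] contains 1, so take its shortest element [k]. An
    initial letter [b] of [k] lies outside [st a.1] and, by minimality, also begins [gl a * k],
    which lies in the same coset of [sgp T]. But [a] begins [gl a * k] too, which forces [a] and [b]
    to be adjacent. *)
Lemma stab_coset (T : {pred V}) a h : h^-1 * gl a * h \in sgp T ->
  exists2 s, s \in sgp (st a.1) & s^-1 * h \in sgp T.
Proof.
move=> aT.
pose P k := exists s t, [/\ s \in sgp (st a.1), t \in sgp T & k = s * h * t].
have Ph : P h by exists 1, 1; rewrite !sgp1 mul1g mulg1.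
have [k [s [t [ss tT kE]]] kmin] := ex_min_len Ph.
have kT : k^-1 * gl a * k \in sgp T.
  have -> : k^-1 * gl a * k = t^-1 * (h^-1 * gl a * h) * t.
    by rewrite kE !invgM -!mulgA (mulgA (gl a) s) (sgp_st_comm ss) -(mulgA s) mulKg.
  by rewrite sgpM // sgpM // sgpV.
case: (eqVneq k 1) => [k1|/beg_ex[b bk]].
  exists s^-1; first exact: sgpV.
  have -> : s^-1^-1 * h = t^-1 by apply: (mulIg t); rewrite invgK -kE k1 mulVg.
  exact: sgpV.
have kmT : min_coset T k.
  move=> t' t'T; apply: kmin; exists s, (t * t'); split=> //; first exact: sgpM.
  by rewrite kE !mulgA.
have nb : b.1 \notin st a.1.
  apply/negP => ba; have /kmin : P (gl (linv b) * k).
    exists (gl (linv b) * s), t; split=> //; last by rewrite kE !mulgA.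
    by rewrite sgpM // gl_sgp.
  by rewrite -(len_beg bk) ltnn.
have := min_coset_beg kmT bk kT; rewrite -mulgA mulVKg => bak.
have nab : b != a by apply: contraNneq nb => ->; apply: st_refl.
have nba : ~~ e a.1 b.1 by apply: contra nb; rewrite inE => ->; rewrite orbT.
have nla : ~~ beg (linv a) k.
  apply/negP => ak; case/negP: nba; rewrite -[a.1]/(linv a).1; apply: beg2_adj ak bk _.
  by apply: contraNneq nb => <-; apply: (st_refl a.1).
case/negP: nba; apply: beg2_adj bak _; last by rewrite eq_sym.
by rewrite begM.
Qed.

Lemma cent_gl a h : commute (gl a) h -> h \in sgp (st a.1).
Proof.
move=> ah; have [|s ss sh] := @stab_coset (st a.1) a h.
  by rewrite -mulgA ah mulKg gl_sgp st_refl.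
by rewrite -(mulVKg s h) sgpM.
Qed.

(** The conjugate of [gl a] by [f^-1] centralises [gl b], hence lies in [sgp (st b.1)]. Then
    [stab_coset] factors [f] through the two star subgroups, and the factorisation yields a common
    element of the two cosets. *)
Lemma commute_conj_common a b g h : e a.1 b.1 ->
  commute (g * gl a * g^-1) (h * gl b * h^-1) ->
  exists k, g^-1 * k \in sgp (st a.1) /\ h^-1 * k \in sgp (st b.1).
Proof.
move=> ab C; pose f := g^-1 * h.
have : commute (gl b) (f^-1 * gl a * f).
  have -> : f^-1 * gl a * f = (g * gl a * g^-1) ^ h.
    by rewrite /f /conjg invgM invgK !mulgA.
  have -> : gl b = (h * gl b * h^-1) ^ h.
    by rewrite /conjg !mulgA mulgVK mulVg mul1g.
  by rewrite /commute -!conjMg C.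
move/cent_gl/stab_coset=> [s sa sb]; exists (g * s); rewrite mulKg; split=> //.
have -> : h^-1 * (g * s) = (s^-1 * f)^-1 by rewrite /f !invgM !invgK !mulgA.
exact: sgpV.
Qed.

Lemma last_split g : g != 1 -> exists w d, red (rcons w d) /\ g = el (rcons w d).
Proof.
move=> g1; have := wdK g; have := red_wd g; case/lastP: (wd g) => [|w d] r gE.
  by rewrite -gE eqxx in g1.
by exists w, d.
Qed.

(** No link lies in the star of another vertex; this excludes transvections. *)
Definition undominated := forall x y, x != y -> exists2 z, e x z & z \notin st y.

(* Otherwise the hyperplane dual to the last edge of a shortest path from [1] to the coset
   of [a.1] would be crossed by the cosets of all neighbours of [a.1], and its label would
   dominate [a.1]. *)
Lemma no_isolated_side a (c : V -> G) : undominated ->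
  min_coset (st a.1) (c a.1) -> beg a (c a.1) ->
  (forall z, e a.1 z -> exists k, (c a.1)^-1 * k \in sgp (st a.1) /\ (c z)^-1 * k \in sgp (st z)) ->
  (forall z, e a.1 z -> exists2 l, l \in sgp (lk a.1) & (c z)^-1 * l \in sgp (st z)) ->
  False.
Proof.
move=> undom umin ua com cross; have u1 : c a.1 != 1.
  by apply: contraTneq ua => ->; rewrite beg1.
have [w [d [r uE]]] := last_split u1.
have rw : red w by move: r; rewrite -red_rev rev_rcons /= red_rev => /andP[].
pose u' := el w; have {}uE : c a.1 = u' * gl d by rewrite uE el_rcons.
have lenu : len (c a.1) = (len u').+1 by rewrite uE -el_rcons !len_red // size_rcons.
have nd : d.1 \notin st a.1.
  apply/negP => da; have /umin : gl (linv d) \in sgp (st a.1) by rewrite gl_sgp.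
  by rewrite lenu uE gl_linv mulgK ltnn.
have nda : a.1 != d.1 by apply: contraNneq nd => <-; apply: st_refl.
have [z az zd] := undom _ _ nda.
have [k [ku kz]] := com z az; have [l la lz] := cross z az.
(* Seen from [u'], the element [k] lies beyond the edge [d], while 1 and [l] lie before it. So the
   coset of [z], which contains [k] and [l], crosses the hyperplane of this edge, and [d.1] lies in
   [st z]. *)
have dk : beg d (u'^-1 * k).
  have -> : u'^-1 * k = gl d * ((c a.1)^-1 * k) by rewrite uE invgM !mulgA mulgV mul1g.
  by rewrite begM; apply: contra nd => /(beg_sgp ku).
have du : beg d u'^-1 = false.
  apply/negP => /len_beg; rewrite gl_linv -invgM -uE !lenV lenu => E.
  by have : len u' < (len u').+2 by []; rewrite E ltnn.
have dl : beg d (u'^-1 * l) = false.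
  case: (eqVneq (beg d (u'^-1 * l)) (beg d u'^-1)) => [->//|/(coset_cross la)[dla _]].
  by case/negP: nd; apply: lk_st.
have kl : l^-1 * k \in sgp (st z).
  rewrite (_ : l^-1 * k = ((c z)^-1 * l)^-1 * ((c z)^-1 * k)); first by rewrite sgpM ?sgpV.
  by rewrite invgM invgK -mulgA mulVKg.
have [|dz _] := @coset_cross _ (st z) d (u'^-1 * l) _ kl.
  by rewrite -mulgA mulVKg dk dl.
by rewrite st_sym dz in zd.
Qed.

End Centralizers.


(** * Families of conjugates of the vertices *)

(** A shift may lengthen the entry of [x] itself by one; two shortened entries pay for it. *)
Lemma sum_lt2 (I : finType) (f f' : I -> nat) x r s :
  (forall v, f' v + (v == r) + (v == s) <= f v + (v == x)) ->
  \sum_v f' v < \sum_v f v.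
Proof.
move=> H.
have S t : \sum_v (v == t : nat) = 1 by rewrite (bigD1 t) //= eqxx big1 // => v /negbTE->.
have : \sum_v (f' v + (v == r) + (v == s)) <= \sum_v (f v + (v == x)) by apply: leq_sum.
rewrite !big_split /= !S; lia.
Qed.

Lemma sum_lt1 (I : finType) (f f' : I -> nat) r :
  (forall v, f' v + (v == r) <= f v) -> \sum_v f' v < \sum_v f v.
Proof.
move=> H.
have S t : \sum_v (v == t : nat) = 1 by rewrite (bigD1 t) //= eqxx big1 // => v /negbTE->.
have : \sum_v (f' v + (v == r)) <= \sum_v f v by apply: leq_sum.
rewrite !big_split /= !S; lia.
Qed.

Section Sections.
Variable V : sgraph.
Local Notation e := (@adj V).
Local Notation G := (raag V).
Implicit Types (a b d : V * bool) (u v x y z : V) (g h k : G) (c : V -> G).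
Local Open Scope group_scope.

(** A colouring constant on the components of the complement of the star of [x]. Connectedness is
    expressed by such colourings rather than by paths, since the side of a hyperplane gives one
    directly. *)
Definition star_constant x (f : V -> bool) :=
  forall u v, u \notin st x -> v \notin st x -> e u v -> f u = f v.

(* [C] is cut off from the rest of the graph by the star of [x] exactly for [x] in [Lam]. *)
Structure cut_graph (C Lam : {pred V}) : Prop := CutGraph {
  cut_undom : undominated V;
  cut_conn : forall x f, x \notin Lam -> star_constant x f ->
    forall u v, u \notin st x -> v \notin st x -> f u = f v;
  cut_conn2 : forall x f, x \in Lam -> star_constant x f ->
    forall u v, u \notin st x -> v \notin st x -> (u \in C) = (v \in C) -> f u = f v;
  cut_nonempty : exists u, u \in C;
  cut_far : forall x u, x \in Lam -> u \in C -> u \notin st x;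
  cut_boundary : forall x u v, x \in Lam -> u \in C -> v \notin C -> e u v ->
    exists r, [/\ e v r, r \notin st x & r \notin C];
  cut_rest : forall x, exists r s,
    [/\ r != s, r \notin st x, s \notin st x, r \notin C & s \notin C] }.

(* The cosets of [u] and [v] meet iff the conjugates of [u] and [v] by [c u] and [c v] commute. *)
Definition section c := forall u v, e u v ->
  exists k, (c u)^-1 * k \in sgp (st u) /\ (c v)^-1 * k \in sgp (st v).

(** The coset of [v] contains an edge dual to the hyperplane of [a], namely the one from [l] to
    [l * gl a]. *)
Definition crossed a c v :=
  a.1 \in st v /\ exists2 l, l \in sgp (lk a.1) & (c v)^-1 * l \in sgp (st v).

(** Along with [l] a crossed coset contains [l * gl a], which equals [gl a * l]; so left
    multiplication by [gl a] preserves it. *)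
Lemma crossed_shift a c v : crossed a c v -> (c v)^-1 * (gl a * c v) \in sgp (st v).
Proof.
case=> av [l la lv]; pose q := (c v)^-1 * l.
have cE : c v = l * q^-1 by rewrite /q invgM invgK mulVKg.
have al : commute (gl a) l by apply: sgp_st_comm; apply: sgpS la; apply: lk_st.
rewrite cE (mulgA (gl a)) al invgM invgK -!mulgA mulKg.
by rewrite mulgA; apply: (sgpM lv); apply: sgpM; [rewrite gl_sgp | exact: sgpV lv].
Qed.

Lemma section_step a c u v : section c -> min_coset (st u) (c u) ->
  e u v -> beg a (c u) -> beg a (c v) \/ crossed a c v.
Proof.
move=> sec minu uv au; have [k [ku kv]] := sec u v uv.
have ak : beg a k by rewrite -(mulVKg (c u) k); exact: (min_coset_beg minu au ku).
case: (boolP (beg a (c v))) => [|nav]; [by left | right].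
have [|av [l la lv]] := @coset_cross _ (st v) a (c v) _ kv.
  by rewrite mulVKg ak (negPf nav).
by split=> //; exists l.
Qed.

Lemma section_ext c c' : section c -> (forall v, (c v)^-1 * c' v \in sgp (st v)) -> section c'.
Proof.
move=> sec H u v /sec[k [ku kv]]; exists k.
suff S p : (c p)^-1 * k \in sgp (st p) -> (c' p)^-1 * k \in sgp (st p) by split; apply: S.
move=> kp; have := sgpM (sgpV (H p)) kp.
by rewrite invgM invgK -mulgA mulVKg.
Qed.

(** Only edges between [D] and its complement need care. There a common element survives, possibly
    translated by [t], as soon as [t] preserves one of the two cosets. *)
Lemma section_shift (D : pred V) c t : section c ->
  (forall u v, D u -> ~~ D v -> e u v ->
     (c u)^-1 * (t * c u) \in sgp (st u) \/ (c v)^-1 * (t * c v) \in sgp (st v)) ->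
  section (fun v => if D v then t * c v else c v).
Proof.
move=> sec HB.
suff H u v : D u -> ~~ D v -> e u v -> exists k,
    (t * c u)^-1 * k \in sgp (st u) /\ (c v)^-1 * k \in sgp (st v).
  move=> u v uv; case: (boolP (D u)) (boolP (D v)) => Du [] Dv.
  - have [k [ku kv]] := sec u v uv; exists (t * k).
    by rewrite !invgM -!mulgA !mulKg.
  - exact: H.
  - by have [|k [ku kv]] := H v u Dv Du; [rewrite adj_sym | exists k].
  - exact: sec.
move=> Du Dv uv; have [k [ku kv]] := sec u v uv.
have [Hu|Hv] := HB u v Du Dv uv; [exists k | exists (t * k)]; split=> //.
- have := sgpM (sgpV Hu) ku.
  by rewrite !invgM !invgK -!mulgA mulVKg.
- by rewrite !invgM -!mulgA mulKg.
- by have := sgpM Hv kv; rewrite -!mulgA mulVKg.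
Qed.

Variables C Lam : {pred V}.
Hypothesis cut : cut_graph C Lam.

(* The vertices whose coset lies in the half-space
   [beg a] are separated by crossed vertices from those whose coset lies outside;
   the connectivity of the graph leaves only the moves of [C], of its complement
   and of the whole graph, and each of them shortens [c]. *)
Lemma section_descent c : section c -> (forall v, min_coset (st v) (c v)) ->
  (exists v, c v != 1) ->
  exists (c' : V -> G) (t : G) (dC dR : bool),
    [/\ section c', \sum_v len (c' v) < \sum_v len (c v),
        forall v, ((if (if v \in C then dC else dR) then t * c v else c v)^-1 * c' v
                   \in sgp (st v)) &
        forall u v, u \in C -> v \notin C -> e u v ->
          dC = dR \/ (c v)^-1 * (t * c v) \in sgp (st v)].
Proof.
move=> sec minc [v0 /beg_ex[a av0]]; pose x := a.1; pose m v := beg a (c v).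
have step u v : e u v -> m u -> m v \/ crossed a c v.
  by move=> uv; apply: section_step.
have cross_st v : crossed a c v -> v \in st x by case; rewrite st_sym.
(* A crossed coset belongs to a vertex of [st x], so off this star adjacent vertices lie on the same
   side. *)
have mconst : star_constant x m.
  move=> u v ux vx uv; apply/idP/idP => H.
    by have [//|/cross_st vs] := step _ _ uv H; rewrite vs in vx.
  rewrite adj_sym in uv.
  by have [//|/cross_st us] := step _ _ uv H; rewrite us in ux.
have nbr v : v != x -> exists2 z, e v z & z \notin st x by move=> vx; apply: (cut_undom cut vx).
have [r [s [rs rx sx rC sC]]] := cut_rest cut x.
have [q qC] := cut_nonempty cut.
have mR v : v \notin st x -> v \notin C -> m v = m r.
  move=> vx vC; case: (boolP (x \in Lam)) => xL.
    by apply: (cut_conn2 cut xL mconst) => //; rewrite (negPf vC) (negPf rC).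
  exact: (cut_conn cut xL mconst).
have [mC [mCP mCL]] : exists mC, (forall v, v \notin st x -> v \in C -> m v = mC)
                                 /\ (x \notin Lam -> mC = m r).
  case: (boolP (x \in Lam)) => xL.
    exists (m q); split=> // v vx vC; apply: (cut_conn2 cut xL mconst) => //.
      exact: (cut_far cut xL qC).
    by rewrite vC qC.
  by exists (m r); split=> // v vx vC; apply: (cut_conn cut xL mconst).
have mst v : v \notin st x -> m v = if v \in C then mC else m r.
  by move=> vx; case: ifP => vC; [apply: mCP | apply: mR; rewrite ?vC].
pose la := gl (linv a).
have cr_la v : crossed a c v -> (c v)^-1 * (la * c v) \in sgp (st v).
  by move=> H; apply: crossed_shift.
have lenla v : m v -> (len (la * c v)).+1 = len (c v) by apply: len_beg.
have xx : x \in st x by apply: st_refl.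
have rnx : r != x by apply: contraNneq rx => ->.
have snx : s != x by apply: contraNneq sx => ->.
(* Translating all of [D] by [la] and applying [c'] give the same cosets: the vertices of [D] left
   in place by [c'] are crossed, so [la] preserves their cosets. The vertex [x] need not be crossed,
   and is translated even if it lies before the hyperplane. *)
have shift (dC dR : bool) : let D v := if v \in C then dC else dR in
   let c' v := if D v && (m v || (v == x)) then la * c v else c v in
   (forall v, D v -> ~~ m v -> v != x -> crossed a c v) ->
   (forall u v, u \in C -> v \notin C -> e u v -> dC = dR \/ crossed a c v) ->
   \sum_v len (c' v) < \sum_v len (c v) ->
   exists (c' : V -> G) (t : G) (dC dR : bool),
    [/\ section c', \sum_v len (c' v) < \sum_v len (c v),
        forall v, ((if (if v \in C then dC else dR) then t * c v else c v)^-1 * c' v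
                   \in sgp (st v)) &
        forall u v, u \in C -> v \notin C -> e u v ->
          dC = dR \/ (c v)^-1 * (t * c v) \in sgp (st v)].
  move=> D c' HD HB lt; exists c', la, dC, dR.
  have sh v : (if D v then la * c v else c v)^-1 * c' v \in sgp (st v).
    rewrite /c'; case Dv: (D v) => /=; last by rewrite mulVg sgp1.
    case: ifP => [_|/negbT/norP[nm vx]]; first by rewrite mulVg sgp1.
    have := sgpV (cr_la v (HD v Dv nm vx)).
    by rewrite !invgM !invgK.
  split=> // [|u v uC vC /(HB u v uC vC)[->|/cr_la]]; [|by left|by right].
  apply: section_ext sh; apply: section_shift => // u v.
  rewrite /D; case: ifP => uC; case: ifP => vC //.
  - by move=> ->.
  - move=> dCt dRf uv; have [E|H] := HB u v uC (negbT vC) uv; last by right; apply: cr_la.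
    by rewrite -E dCt in dRf.
  - rewrite adj_sym => dRt dCf uv; have [E|H] := HB v u vC (negbT uC) uv; last by left; apply: cr_la.
    by rewrite E dRt in dCf.
  - by move=> ->.
have ms : m s = m r by apply: mR.
have bound (D : pred V) v :
    len (if D v && (m v || (v == x)) then la * c v else c v) + (D v && m v)
    <= len (c v) + (v == x).
  case: (D v) => /=; last by rewrite addn0 leq_addr.
  case mv: (m v) => /=; first by rewrite addn1 lenla // leq_addr.
  by rewrite addn0; case: eqP => _ /=; rewrite ?addn1 ?leq_addr // len_gl_mul.
have bound2 (D : pred V) v : D r -> D s -> m r ->
    len (if D v && (m v || (v == x)) then la * c v else c v) + (v == r) + (v == s)
    <= len (c v) + (v == x).
  move=> Dr Ds mr; apply: leq_trans (bound D v); rewrite -addnA leq_add2l.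
  case: (eqVneq v r) => [->|_]; first by rewrite Dr mr (negPf rs).
  by case: (eqVneq v s) => [->|//]; rewrite Ds ms mr.
(* The four cases translate the whole graph, the complement of [C], and [C]; in the last one only
   the coset of [x] could lie beyond the hyperplane, against [no_isolated_side]. *)
case mr: (m r); case mc: mC.
- apply: (shift true true) => [v _ nm vx|u v _ _ _|]; [|by left|].
    have [z vz zx] := nbr v vx; rewrite adj_sym in vz.
    have mz : m z by rewrite mst // mr mc if_same.
    by have [mv|//] := step _ _ vz mz; rewrite mv in nm.
  by apply: (sum_lt2 (x := x) (r := r) (s := s)) => v;
    apply: (bound2 (fun v => if v \in C then true else true)); rewrite /= ?if_same.
- have xL : x \in Lam by apply: contraT => /mCL E; rewrite E mr in mc.
  have bd u v : u \in C -> v \notin C -> e u v -> crossed a c v.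
    move=> uC vC uv; have [p [vp px pC]] := cut_boundary cut xL uC vC uv.
    have mp : m p by rewrite mst // (negPf pC).
    rewrite adj_sym in vp; have [mv|//] := step _ _ vp mp.
    have ux := cut_far cut xL uC; rewrite adj_sym in uv.
    have [|/cross_st us] := step _ _ uv mv; last by rewrite us in ux.
    by rewrite mst // uC mc.
  apply: (shift false true) => [v|u v uC vC uv|]; last 1 first.
  + apply: (sum_lt2 (x := x) (r := r) (s := s)) => v.
    by apply: (bound2 (fun v => if v \in C then false else true)); rewrite ?(negPf rC) ?(negPf sC).
  + case: ifP => // /negbT vC _ nm vx; have [z vz zx] := nbr v vx.
    rewrite adj_sym in vz; case: (boolP (z \in C)) => zC; first exact: bd zC vC vz.
    have mz : m z by rewrite mst // (negPf zC).
    by have [mv|//] := step _ _ vz mz; rewrite mv in nm.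
  + by right; apply: bd uC vC uv.
- have xL : x \in Lam by apply: contraT => /mCL E; rewrite E mr in mc.
  have mCt v : v \in C -> m v by move=> vC; rewrite mst ?vC // (cut_far cut xL vC).
  apply: (shift true false) => [v|u v uC vC uv|]; last 1 first.
  (* As [x] is not in [C] by [cut_far], no coset gets longer and one shortened vertex suffices. *)
  + apply: (sum_lt1 (r := q)) => v.
    have := bound (fun v => if v \in C then true else false) v.
    case: (boolP (v \in C)) => vC /=; last first.
      by move=> _; rewrite (eq_sym v q) (negPf (memPn vC q qC)) addn0.
    rewrite (_ : (v == x) = false) ?addn0; last first.
      by apply/negP => /eqP vx; have := cut_far cut xL vC; rewrite vx xx.
    by apply: leq_trans; rewrite leq_add2l mCt // leq_b1.
  + by case: ifP => // vC _; rewrite mCt.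
  + right; have [p [vp px pC]] := cut_boundary cut xL uC vC uv.
    have [mv|//] := step _ _ uv (mCt _ uC).
    have [|/cross_st us] := step _ _ vp mv; last by rewrite us in px.
    by rewrite mst // (negPf pC) mr.
- exfalso.
  have mF v : v \notin st x -> m v = false by move=> vx; rewrite mst // mr mc if_same.
  have only_x v : m v -> v = x.
    move=> mv; apply/eqP; apply: contraT => vx; have [z vz zx] := nbr v vx.
    by have [|/cross_st zs] := step _ _ vz mv; [rewrite mF | rewrite zs in zx].
  have E0 := only_x _ av0; rewrite E0 in av0.
  apply: (no_isolated_side (cut_undom cut) (minc x) av0) => [z xz|z xz]; first exact: sec.
  have [/only_x zx|[_ //]] := step _ _ xz av0.
  by rewrite zx adj_irr in xz.
Qed.

(** Induction on the total length: either some [c v] is not minimal in its coset and is replaced, or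
    [section_descent] applies, until all [c v] are 1. The translations accumulate in [A] on [C] and
    in [B] elsewhere. A translation of one side only preserves the boundary cosets, which keeps
    [B^-1 * A] in their star subgroups. *)
Lemma section_rigid c : section c ->
  exists A B : G, (forall v, (if v \in C then A else B)^-1 * c v \in sgp (st v)) /\
    (forall u v, u \in C -> v \notin C -> e u v -> B^-1 * A \in sgp (st v)).
Proof.
have [n] := ubnP (\sum_v len (c v))%N; elim: n c => // n IH c lt_n sec.
case: (classic (forall v, min_coset (st v) (c v))) => [minc|].
  case: (classic (exists v, c v != 1)) => [nt|triv]; last first.
    exists 1, 1; split=> [v|u v _ _ _]; last by rewrite mulVg sgp1.
    rewrite if_same invg1 mul1g; suff -> : c v = 1 by apply: sgp1.
    by apply/eqP/negP => H; apply: triv; exists v; apply/negP.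
  have [c' [t [dC [dR [sec' lt H HB]]]]] := section_descent sec minc nt.
  have [A [B [AB BA]]] := IH c' (leq_trans lt lt_n) sec'.
  have AB' v : (if v \in C then A else B)^-1
      * (if (if v \in C then dC else dR) then t * c v else c v) \in sgp (st v).
    by have := sgpM (AB v) (sgpV (H v)); rewrite invgM invgK -!mulgA mulVKg.
  exists (if dC then t^-1 * A else A), (if dR then t^-1 * B else B); split=> [v|u v uC vC uv].
    have := AB' v; case: (v \in C); [case: (dC) | case: (dR)];
      by rewrite ?invgM ?invgK -?mulgA.
  have BAv := BA u v uC vC uv; have := AB' v; rewrite (negPf vC).
  case: (HB u v uC vC uv) => [->|tv].
    by case: (dR) => //; rewrite invgM invgK -mulgA mulVKg.
  case: (dC); case: (dR) => // Bv.
  - by rewrite invgM invgK -mulgA mulVKg.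
  - have := sgpM (sgpM Bv (sgpM (sgpV tv) (sgpV Bv))) BAv.
    by rewrite !invgM !invgK -!mulgA !mulVKg.
  - have := sgpM (sgpM Bv (sgpM tv (sgpV Bv))) BAv.
    by rewrite !invgM !invgK -!mulgA !mulVKg.
move/not_all_ex_not=> [v Hv]; have [t Ht] := not_all_ex_not _ _ Hv.
have [tv /negP] := imply_to_and _ _ Ht; rewrite -ltnNge => lt.
pose c' u := if u == v then c v * t else c u.
have H u : (c u)^-1 * c' u \in sgp (st u).
  by rewrite /c'; case: eqP => [->|_]; rewrite ?mulKg ?mulVg ?sgp1.
have [||A [B [AB BA]]] := IH c'; last 1 first.
- exists A, B; split=> // u; have := sgpM (AB u) (sgpV (H u)).
  by rewrite invgM invgK -!mulgA mulVKg.
- apply: (@leq_trans (\sum_v len (c v))%N); last exact: lt_n.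
  apply: (sum_lt1 (r := v)) => u.
  by rewrite /c'; case: eqP => [->|_]; rewrite ?addn1 ?addn0.
- exact: section_ext sec H.
Qed.

End Sections.


(** * Exponents and conjugacy *)

Import GRing.Theory Num.Theory.

Section Exponents.
Variable V : sgraph.
Local Notation e := (@adj V).
Local Notation letter := (V * bool)%type.
Local Notation G := (raag V).
Implicit Types (a b c d : letter) (u v w : seq letter) (x y z : V) (g h k : G).
Local Open Scope ring_scope.

Definition sgn (b : bool) : int := if b then -1 else 1.

Definition wexp z w : int := \sum_(c <- w | c.1 == z) sgn c.2.

Lemma wexp_nil z : wexp z [::] = 0. Proof. exact: big_nil. Qed.

Lemma wexp_cons z c w : wexp z (c :: w) = (if c.1 == z then sgn c.2 else 0) + wexp z w.
Proof. by rewrite /wexp big_cons; case: ifP => //; rewrite add0r. Qed.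

Lemma wexp_cat z u v : wexp z (u ++ v) = wexp z u + wexp z v.
Proof. exact: big_cat. Qed.

Lemma sgnN (b : bool) : sgn (~~ b) = - sgn b. Proof. by case: b. Qed.

Lemma wexp_raag_eq z u v : raag_eq e u v -> wexp z u = wexp z v.
Proof.
elim=> [? ? [p q x b|p q x y b c xy]|w|p q _ IH|p q w _ IH1 _ IH2] //.
- rewrite !wexp_cat !wexp_cons /= sgnN; case: ifP => _; ring.
- rewrite !wexp_cat !wexp_cons; ring.
- by rewrite IH1.
Qed.

Definition gexp z g := wexp z (wd g).

Lemma gexp_el z w : gexp z (el w) = wexp z w.
Proof. by apply: wexp_raag_eq; apply/elP; rewrite wdK. Qed.

Lemma gexpM z g h : gexp z (g * h)%g = gexp z g + gexp z h.
Proof. by rewrite -(wdK g) -(wdK h) -el_cat !gexp_el wexp_cat. Qed.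

Lemma gexp1 z : gexp z 1%g = 0.
Proof. by rewrite -el_nil gexp_el wexp_nil. Qed.

Lemma gexpV z g : gexp z g^-1%g = - gexp z g.
Proof. by apply/eqP; rewrite -addr_eq0 -gexpM mulVg gexp1. Qed.

Lemma gexp_conj z g k : gexp z (k * g * k^-1)%g = gexp z g.
Proof. by rewrite !gexpM gexpV; ring. Qed.

Lemma gexpX z g n : gexp z (g ^+ n)%g = gexp z g *+ n.
Proof. by elim: n => [|n IH]; rewrite ?gexp1 // expgS gexpM IH mulrS. Qed.

Lemma gexp_sgp (T : {pred V}) z g : g \in sgp T -> z \notin T -> gexp z g = 0.
Proof.
rewrite inE => /allP gT zT; rewrite /gexp /wexp big_seq_cond big1 // => c.
by case/andP=> /gT cT /eqP cz; rewrite -cz cT in zT.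
Qed.

Fixpoint wpow w n := if n is n'.+1 then w ++ wpow w n' else [::].

Lemma el_wpow w n : el (wpow w n) = (el w ^+ n)%g :> G.
Proof. by elim: n => //= n IH; rewrite el_cat IH expgS. Qed.

Lemma count_wpow (P : pred letter) w n : count P (wpow w n) = (n * count P w)%N.
Proof. by elim: n => //= n IH; rewrite count_cat IH mulSn. Qed.

Lemma wbeg_cat a u v :
  wbeg a (u ++ v) = wbeg a u || (all (fun c => e a.1 c.1) u && wbeg a v).
Proof.
elim: u => //= c u IH; rewrite !wbeg_cons IH.
by case: (c == a) => //=; case: (e a.1 c.1).
Qed.

Lemma red_catr u v : red (u ++ v) -> red v.
Proof. by elim: u => //= c u IH /andP[_ /IH]. Qed.

Lemma red_catl u v : red (u ++ v) -> red u.
Proof. by rewrite -red_rev rev_cat => /red_catr; rewrite red_rev. Qed.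

Lemma red_cat u v : red u -> red v ->
  (forall a, wbeg a (rev u) -> ~~ wbeg (linv a) v) -> red (u ++ v).
Proof.
elim: u => //= c u IH /andP[nc ru] rv H; rewrite IH // ?andbT.
  rewrite wbeg_cat (negPf nc) /=; apply/negP => /andP[al B].
  have Bc : wbeg c (rev (c :: u)).
    by rewrite rev_cons -cats1 wbeg_cat all_rev al wbeg_cons eqxx orbT.
  by rewrite (negPf (H c Bc)) in B.
by move=> a B; apply: H; rewrite rev_cons wbeg_rcons_mono.
Qed.

Definition cyc_min g := forall k, (len g <= len (k^-1 * g * k)%g)%N.

(** A cancellation between consecutive copies would pair a final letter of [wd g] with an initial
    inverse, and conjugating by that letter would shorten [g]. *)
Lemma cyc_min_red g n : cyc_min g -> red (wpow (wd g) n).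
Proof.
move=> gmin; elim: n => // n IH /=; apply: red_cat => //; first exact: red_wd.
move=> a B; apply/negP; case: n {IH} => // n /=; rewrite wbeg_cat => /orP[B'|]; last first.
  case/andP=> /allP al _; case/wbegP: B => m [q [rE _]].
  have : a \in wd g by rewrite -mem_rev rE mem_cat mem_head orbT.
  by move/al; rewrite adj_irr.
have [w1 r1 gE] := beg_split B'.
have P : pe (wd g) (linv a :: w1) by apply: red_pe; rewrite ?red_wd ?wdK.
have rw1 : red w1 by case/andP: r1.
have : wbeg a (rcons (rev w1) (linv a)) by rewrite -rev_cons -(pe_wbeg _ (pe_rev P)).
move=> /wbeg_rcons[|[/eqP]]; last by rewrite linv_neq.
rewrite /wbeg; case D: del => [w2|] // _.
have P2 := pe_rev (del_pe D); rewrite revK rev_cons in P2.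
have r2 : red (rcons (rev w2) a) by rewrite -(pe_red P2).
have E2 : el w1 = (el (rev w2) * gl a)%g by rewrite -el_rcons; apply/elP/pe_raag_eq.
have rw2 : red (rev w2) by move: r2; rewrite -red_rev rev_rcons /= red_rev => /andP[].
have E : ((gl (linv a))^-1 * g * gl (linv a) = el (rev w2))%g.
  by rewrite gE el_cons gl_linv invgK mulVKg E2 mulgK.
have := gmin (gl (linv a)); rewrite E len_red // gE len_red //=.
by rewrite (perm_size (pe_perm P2)) size_rcons ltnNge leqnSn.
Qed.

Lemma count_nf (P : pred letter) w : (count P (nf w) <= count P w)%N.
Proof.
elim: w => //= a w; rewrite /push; case D: del => [w'|] /=; last by rewrite leq_add2l.
by rewrite (seq.permP (del_perm D)) /=; lia.
Qed.

Lemma count_red (P : pred letter) u v : red u -> el u = el v -> (count P u <= count P v)%N.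
Proof.
move=> ru uv; have /pe_perm/seq.permP-> : pe u (nf v); last exact: count_nf.
apply: red_pe => //; first exact: red_nf.
by rewrite uv; apply/elP/nf_raag_eq.
Qed.

(** Count the letters at a vertex outside [T] in [g ^+ n], which is [k * q ^+ n * k^-1]. The reduced
    word on the left has at least [n] of them, the one on the right at most [2 * len k]; so [n] is
    taken one larger. *)
Lemma cyc_min_conj_sgp (T : {pred V}) g k :
  cyc_min g -> (k^-1 * g * k)%g \in sgp T -> g \in sgp T.
Proof.
move=> gmin qT; rewrite inE; apply/allP => c cg; apply: contraT => cT.
pose P := [pred d : letter | d.1 == c.1]; pose q := (k^-1 * g * k)%g.
have [n nE] : exists n, n = (len k + len k).+1 by eexists.
have := @count_red P (wpow (wd g) n) (wd k ++ wpow (wd q) n ++ inv_word (wd k)).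
rewrite !el_cat !el_wpow el_inv !wdK cyc_min_red //.
have -> : (g ^+ n = k * (q ^+ n * k^-1))%g.
  have -> : g = (q ^ k^-1)%g by rewrite /q /conjg invgK -!mulgA mulgV mulg1 mulVKg.
  by rewrite -conjXg /conjg invgK.
move=> /(_ isT erefl); rewrite !count_cat !count_wpow.
have -> : count P (wd q) = 0%N.
  apply/eqP; rewrite -leqn0 leqNgt -has_count; apply/hasPn => d dq.
  by apply: contraNN cT => /eqP<-; move: qT; rewrite inE => /allP; apply.
have : (0 < count P (wd g))%N by rewrite -has_count; apply/hasP; exists c => //=.
have := count_size P (wd k); have := count_size P (inv_word (wd k)).
have -> : size (inv_word (wd k)) = len k by rewrite /inv_word size_rev size_map.
rewrite -/(len k) nE; move: (count _ _) (count _ _) (count _ _) (len k) => p1 p2 p3 l.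
nia.
Qed.

(* heights (values of the exponent sum of [z]) of the edges labelled [z] along
   the path [w] started at height [s] *)
Fixpoint hts z (s : int) w : seq int :=
  if w is c :: w' then
    if c.1 == z then (if c.2 then s - 1 else s) :: hts z (s + sgn c.2) w'
    else hts z s w'
  else [::].

Lemma hts_cat z s u v : hts z s (u ++ v) = hts z s u ++ hts z (s + wexp z u) v.
Proof.
elim: u s => [|c u IH] s /=; first by rewrite wexp_nil addr0.
by rewrite wexp_cons; case: ifP => _; rewrite /= IH ?add0r ?addrA.
Qed.

Lemma hts_proj z s w : hts z s w = hts z s (proj z z w).
Proof. by elim: w s => //= c w IH s; rewrite orbb; case: ifP => //= ->; rewrite IH. Qed.

Lemma pe_hts z s u v : pe u v -> hts z s u = hts z s v.
Proof. by move/peP=> H; rewrite hts_proj H ?adj_irr // -hts_proj. Qed.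

Lemma hts_shift z s w : hts z s w = [seq t + s | t <- hts z 0 w].
Proof.
suff H s' t : hts z (s' + t) w = [seq r + t | r <- hts z s' w] by rewrite -H add0r.
elim: w s' => //= c w IH s'; case: ifP => _ /=; last exact: IH.
rewrite (addrAC s' t (sgn _)) IH; congr (_ :: _).
by case: c.2; rewrite // addrAC.
Qed.

Lemma size_hts z s w : size (hts z s w) = count (fun c => c.1 == z) w.
Proof. by elim: w s => //= c w IH s; case: ifP => _ /=; rewrite IH. Qed.

Lemma hts_bound z w t : t \in hts z 0 w -> `|t| <= (size w)%:Z.
Proof.
suff H s : t \in hts z s w -> `|t - s| <= (size w)%:Z by move/H; rewrite subr0.
elim: w s => //= c w IH s; case: ifP => _; last by move/IH; lia.
by rewrite inE; case: c.2 => /= /orP[/eqP->|/IH]; rewrite /sgn /=; lia.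
Qed.

Lemma hts_linv z s a w : exists p, hts z s (a :: linv a :: w) = p ++ hts z s w.
Proof.
case: a => x b /=; case: (x == z); last by exists [::].
exists [:: if b then s - 1 else s; if ~~ b then s + sgn b - 1 else s + sgn b].
by rewrite sgnN addrK.
Qed.

(** Reduction removes cancelling pairs, whose total exponent is zero, so the heights of the
    remaining edges do not move. *)
Lemma count_hts_nf z s t w : (count_mem t (hts z s (nf w)) <= count_mem t (hts z s w))%N.
Proof.
elim: w s => // a w IH s; rewrite [nf _]/= /push.
apply: (@leq_trans (count_mem t (hts z s (a :: nf w)))); last first.
  by rewrite /=; case: ifP => _ //=; rewrite leq_add2l.
case D: del => [w'|] //; have P := del_pe D.
have -> : hts z s (a :: nf w) = hts z s (a :: linv a :: w').
  by apply: pe_hts; rewrite pe_cons.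
by have [p ->] := hts_linv z s a w'; rewrite count_cat leq_addl.
Qed.

Lemma count_hts_red z s t u v : red u -> el u = el v ->
  (count_mem t (hts z s u) <= count_mem t (hts z s v))%N.
Proof.
move=> ru uv; rewrite (@pe_hts z s u (nf v)); first exact: count_hts_nf.
apply: red_pe => //; first exact: red_nf.
by rewrite uv; apply/elP/nf_raag_eq.
Qed.

Lemma count_hts_wpow z s t w n : wexp z w = 0 ->
  count_mem t (hts z s (wpow w n)) = (n * count_mem t (hts z s w))%N.
Proof.
by move=> w0; elim: n => //= n IH; rewrite hts_cat w0 addr0 count_cat IH mulSn.
Qed.

(* A large power [f] of [h] moves the axis of [g] to heights which the axis
   does not reach, so [f g^j f^-1 = g^j] leaves no room for letters [z]. *)
Lemma cyc_min_height g h z : cyc_min g -> commute g h ->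
  gexp z g = 0 -> gexp z h != 0 -> g \in sgp (predC1 z).
Proof.
move=> gmin gh g0 h0; rewrite inE; apply/allP => c cg; apply/negP => /eqP cz.
(* The heights of [w] are at most [size w] in absolute value, so a shift by at least [N] makes them
   disjoint from the original ones. Likewise [n] below exceeds the number of letters in [f] and its
   inverse together. *)
pose w := wd g; pose N := (size w + size w).+1; pose f := (h ^+ N)%g.
have [n nE] : exists n, n = (len f + len f).+1 by eexists.
have [t tw] : exists t, t \in hts z 0 w.
  have : (0 < size (hts z 0 w))%N.
    by rewrite size_hts -has_count; apply/hasP; exists c => //; apply/eqP.
  by case: (hts z 0 w) => // t s _; exists t; apply: mem_head.
have := @count_hts_red z 0 t (wpow w n) (wd f ++ wpow w n ++ inv_word (wd f)).
rewrite cyc_min_red // !el_cat el_wpow el_inv !wdK.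
have fg : commute f (g ^+ n)%g by apply: commuteX2.
rewrite mulgA fg mulgK => /(_ isT erefl); rewrite !hts_cat !count_cat add0r.
have fE : wexp z (wd f) = gexp z h *+ N by rewrite -/(gexp z f) gexpX.
rewrite !count_hts_wpow //.
have -> : count_mem t (hts z (wexp z (wd f)) w) = 0%N.
  apply/count_memPn; rewrite hts_shift; apply/mapP => -[s sw tE].
  have := hts_bound sw; have := hts_bound tw; move: tE h0; rewrite fE /N.
  by move: (gexp z h) (size w) => m l; rewrite -mulr_natr; nia.
have : (0 < count_mem t (hts z 0 w))%N by rewrite -has_count has_pred1.
have b1 : (count_mem t (hts z 0 (wd f)) <= len f)%N.
  by apply: leq_trans (count_size _ _) _; rewrite size_hts count_size.
have b2 s : (count_mem t (hts z s (inv_word (wd f))) <= len f)%N.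
  apply: leq_trans (count_size _ _) _; rewrite size_hts (leq_trans (count_size _ _)) //.
  by rewrite /inv_word size_rev size_map.
move=> pos le; have {le} := leq_trans le (leq_add b1 (leq_add (leqnn _) (b2 _))).
rewrite muln0 add0n nE; move: (count_mem _ _) (len f) pos => m l; nia.
Qed.

Lemma beg_mulr_sgp (T : {pred V}) a g t : t \in sgp T -> a.1 \notin T ->
  beg a (g * t)%g = beg a g.
Proof.
by move=> tT; apply: contraNeq => /(coset_cross tT)[].
Qed.

(** Split a reduced word of [h] as [u ++ a :: r] at its first letter [a] on [z], and let [q] be the
    conjugate of [g] by [el u]. Then [q * el (a :: r)] equals [el (a :: r) * g] and so lies beyond
    the hyperplane of [a], while [q] does not. The path reading [a :: r] from [q] can enter only at
    its first edge, since a later entry would make a reduced word starting with [a] free of [z].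
    Entering at the first edge means that [q] lies in [sgp (lk z)]. *)
Lemma conj_into_link g h z : g \in sgp (predC1 z) -> commute g h -> gexp z h != 0 ->
  exists k, (k^-1 * g * k)%g \in sgp (lk z).
Proof.
move=> gz gh h0; pose P := fun c : letter => c.1 == z.
have : has P (wd h).
  apply: contraNT h0 => /hasPn H; rewrite (@gexp_sgp (predC1 z)) //; last by rewrite inE /= eqxx.
  by rewrite inE; apply/allP => c /H.
move: (red_wd h) (wdK h) => rh hE /split_find S.
case: S rh hE => a u r az /hasPn uz.
rewrite cat_rcons => rh hE; have {}az : a.1 = z by apply/eqP.
have uz' : el u \in sgp (predC1 z) by apply: el_sgp; apply/allP => c /uz.
exists (el u); have [q qE] : exists q, q = ((el u)^-1 * g * el u)%g by eexists.
rewrite -qE; have qz : q \in sgp (predC1 z) by rewrite qE !sgpM ?sgpV.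
have ra : red (a :: r) by apply: red_catr rh.
have B : beg a (q * el (a :: r))%g.
  have -> : (q * el (a :: r) = el (a :: r) * g)%g.
    rewrite qE; have -> : el (a :: r) = ((el u)^-1 * h)%g by rewrite -hE el_cat mulKg.
    by rewrite !mulgA mulgK -!mulgA gh.
  by rewrite (beg_mulr_sgp _ gz) ?inE ?az ?eqxx // beg_red // wbeg_cons eqxx.
have nq : ~~ beg a q by apply/negP => /(beg_sgp qz); rewrite az inE /= eqxx.
rewrite el_cons mulgA in B.
case: (boolP (beg a (q * gl a)%g)) => [B1|nB1].
  have [|[_]|[/eqP]] := @beg_mulr _ a a q; first by rewrite B1 (negPf nq).
    by rewrite az.
  by rewrite eq_sym linv_neq.
have H v r' p : r = v ++ r' -> p = (q * gl a * el v)%g -> ~~ beg a p -> ~~ beg a (p * el r')%g.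
  elim: r' v p => [|b r' IH] v p rE pE nB; first by rewrite el_nil mulg1.
  rewrite el_cons mulgA; apply: (IH (rcons v b)); first by rewrite cat_rcons.
    by rewrite pE el_rcons !mulgA.
  apply/negP => B2; have [|[ba plk]|[ba plk]] := @beg_mulr _ a b p.
  - by rewrite B2 (negPf nB).
  - have : el (a :: v) \in sgp (predC1 z).
      have -> : el (a :: v) = (q^-1 * p)%g by rewrite pE el_cons -!mulgA mulKg.
      rewrite sgpM ?sgpV //; apply: sgpS plk => y; rewrite az !inE => /adj_neq.
      by rewrite eq_sym.
    have rv : red (a :: v).
      by move: ra; rewrite rE -cat_cons => /red_catl.
    by rewrite red_sgp //= inE az eqxx.
  - by have := beg_sgp plk B2; rewrite inE adj_irr.
have := H [::] r _ erefl; rewrite el_nil mulg1 => /(_ _ erefl nB1).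
by rewrite B.
Qed.

Lemma red_const_vertex w x : red w -> all (fun c => c.1 == x) w ->
  exists (n : nat) (b : bool), w = nseq n (x, b).
Proof.
elim: w => [|[y b] w IH] /=; first by exists 0%N, true.
case/andP=> nb rw /andP[/eqP yx /(IH rw)[n [b' wE]]]; subst y.
exists n.+1, b; rewrite wE /=; congr (_ :: _).
case: n wE => // n wE; suff -> : b' = b by [].
apply/eqP; apply: contraNT nb => bb; have bE : b' = ~~ b by case: b' b bb {wE} => -[].
by rewrite wE bE wbeg_cons eqxx.
Qed.

Lemma wexp_nseq x n (b : bool) : wexp x (nseq n (x, b)) = sgn b *+ n.
Proof. by elim: n => [|n IH] /=; rewrite ?wexp_nil // wexp_cons IH eqxx mulrS. Qed.

(** For a shortest conjugate [g0], the height argument and [conj_into_link] put [g0] in [sgp (lk z)]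
    for every neighbour [z] of [x]. As no other vertex dominates [x], these links meet only in [x],
    so [g0] is a power of [x], and the exponent makes it [x] itself. *)
Lemma conj_of_exponents g x : undominated V -> gexp x g = 1 ->
  (forall z, e x z -> gexp z g = 0 /\ exists2 h, commute g h & gexp z h != 0) ->
  exists k, (g = k * gl (x, false) * k^-1)%g.
Proof.
move=> undom gx H.
have g1 : exists k, g = (k^-1 * g * k)%g by exists 1%g; rewrite invg1 mul1g mulg1.
have [g0 [k g0E] min0] := ex_min_len (P := fun g' => exists k, g' = (k^-1 * g * k)%g) g1.
have gE : (g = k * g0 * k^-1)%g by rewrite g0E -!mulgA mulgV mulg1 mulVKg.
have cmin : cyc_min g0.
  by move=> k'; apply: min0; exists (k * k')%g; rewrite g0E invgM !mulgA.
have gexp0 z : gexp z g0 = gexp z g by rewrite gE gexp_conj.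
have sub z : e x z -> g0 \in sgp (lk z).
  move=> xz; have [gz [h gh hz]] := H z xz.
  have C : commute g0 (h ^ k)%g.
    by rewrite g0E -mulgA -/(conjg g k) /commute -!conjMg gh.
  have hz' : gexp z (h ^ k)%g != 0.
    by rewrite /conjg !gexpM gexpV addrCA addNr addr0.
  have g0z : g0 \in sgp (predC1 z) by apply: cyc_min_height C _ hz' => //; rewrite gexp0.
  by have [k' /(cyc_min_conj_sgp cmin)] := conj_into_link g0z C hz'.
have all_x : all (fun c => c.1 == x) (wd g0).
  apply/allP => c cg; apply: contraT => cx.
  rewrite eq_sym in cx; have [z xz zc] := undom x c.1 cx.
  have := sub z xz; rewrite inE => /allP/(_ c cg); rewrite inE => zc'.
  by rewrite st_sym inE zc' orbT in zc.
have [n [b wE]] := red_const_vertex (red_wd g0) all_x.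
have := gexp0 x; rewrite gx /gexp wE wexp_nseq => bn.
exists k; rewrite gE -(wdK g0) wE /gl.
suff [-> ->] : n = 1%N /\ b = false by [].
by case: b bn {wE}; rewrite /sgn; lia.
Qed.

End Exponents.


(** * Action on the abelianisation *)

Section LinearAlgebra.
Local Open Scope ring_scope.
Variables (F : fieldType) (I : finType).

(** Some term in the Leibniz expansion of a non-zero determinant is non-zero. *)
Lemma invertible_transversal (M N : I -> I -> F) :
  (forall i k, \sum_j M i j * N j k = (i == k)%:R) ->
  exists2 s : I -> I, injective s & forall i, M i (s i) != 0.
Proof.
move=> MN; pose A := \matrix_(i < #|I|, j < #|I|) M (enum_val i) (enum_val j).
pose B := \matrix_(i < #|I|, j < #|I|) N (enum_val i) (enum_val j).
have AB : A *m B = 1%:M.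
  apply/matrixP => i k; rewrite !mxE -(inj_eq enum_val_inj) -MN.
  rewrite (reindex (@enum_val I I)) /=; last exact/onW_bij/enum_val_bij.
  by apply: eq_bigr => j _; rewrite !mxE.
have dA : \det A != 0.
  apply: contra_eq_neq (congr1 determinant AB) => A0.
  by rewrite det_mulmx A0 mul0r det1 eq_sym oner_eq0.
have [s sP] : exists s : 'S_#|I|, \prod_i A i (s i) != 0.
  apply/existsP; apply: contraNT dA => /existsPn H; apply/eqP.
  by apply: big1 => s _; have /negPn/eqP-> := H s; rewrite mulr0.
exists (fun i => enum_val (s (enum_rank i))) => [i j /enum_val_inj/perm_inj/enum_rank_inj //|i].
move/prodf_neq0: sP => /(_ (enum_rank i) isT).
by rewrite mxE enum_rankK.
Qed.

Lemma row_independent_card (R C : {pred I}) (M : I -> I -> F) :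
  (forall a : I -> F, (forall j, j \in C -> \sum_(i in R) a i * M i j = 0) ->
     forall i, i \in R -> a i = 0) -> (#|R| <= #|C|)%N.
Proof.
move=> H; pose A := \matrix_(i < #|R|, j < #|C|) M (enum_val i) (enum_val j).
suff /eqP <- : row_free A by apply: rank_leq_col.
apply: inj_row_free => u uA.
have R0 (i : 'I_#|R|) : enum_val i \in R by apply: enum_valP.
pose a (k : I) : F := \sum_(i < #|R| | enum_val i == k) u 0 i.
have aE i : a (enum_val i) = u 0 i.
  by rewrite /a (big_pred1 i) // => j; rewrite (inj_eq enum_val_inj).
apply/rowP => i; rewrite mxE -aE; apply: H => // j jC.
move/rowP/(_ (enum_rank_in jC j)): uA; rewrite !mxE => uA.
rewrite big_enum_val -[RHS]uA; apply: eq_bigr => k _.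
by rewrite aE !mxE enum_rankK_in.
Qed.

End LinearAlgebra.

(** * Monomiality of the matrix of an automorphism *)

Section Monomial.
Local Open Scope ring_scope.
Variable V : sgraph.
Local Notation e := (@adj V).
Implicit Types u v w x y z : V.

(** If [M v w] is non-zero, a combination of the rows in [st v] vanishing in column [w] vanishes in
    every column outside [st w]. So the columns in [st w] detect independence of these rows, and
    [st v] is at most as large as [st w]. Summing over the transversal [s] gives equality for
    [w = s v]. A second non-zero entry [y] of row [v] would determine a column [z] of [st (s v)]
    outside [st y], leaving too few columns. *)
Lemma monomial_of_commuting (F : fieldType) (M N : V -> V -> F) : undominated V ->
  (forall i k, \sum_j M i j * N j k = (i == k)%:R) ->
  (forall u v z w, u \in st v -> w \notin st z -> M u z * M v w = M u w * M v z) ->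
  exists2 s : V -> V, injective s &
    (forall v, M v (s v) != 0) /\ (forall v w, w != s v -> M v w = 0).
Proof.
move=> undom MN comm; have [s sinj sM] := invertible_transversal MN.
exists s => //; split=> // v.
(* A combination of rows of [M] that vanishes in every column is trivial, as one sees by multiplying
   with [N]. *)
have indep v0 (T : {pred V}) :
  (forall a : V -> F, (forall j, j \in T -> \sum_(i in st v0) a i * M i j = 0) ->
     forall j, \sum_(i in st v0) a i * M i j = 0) -> (#|st v0| <= #|T|)%N.
  move=> H; apply: (@row_independent_card F V (st v0) T M) => a aT i0 i0v.
  have {}aT := H a aT.
  pose b i := if i \in st v0 then a i else 0.
  have bM j : \sum_i b i * M i j = 0.
    rewrite -[RHS](aT j) [RHS]big_mkcond; apply: eq_bigr => i _.
    by rewrite /b; case: ifP; rewrite ?mul0r.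
  have : \sum_j (\sum_i b i * M i j) * N j i0 = 0 by apply: big1 => j _; rewrite bM mul0r.
  under eq_bigr do rewrite mulr_suml.
  rewrite exchange_big /=.
  under eq_bigr => i _ do (under eq_bigr do rewrite -mulrA; rewrite -mulr_sumr MN).
  rewrite (bigD1 i0) //= eqxx mulr1 big1 ?addr0; first by rewrite /b i0v.
  by move=> i /negPf->; rewrite mulr0.
have prop v0 (a : V -> F) z w : M v0 w != 0 -> w \notin st z ->
    \sum_(i in st v0) a i * M i w = 0 -> \sum_(i in st v0) a i * M i z = 0.
  move=> nz wz w0; apply: (mulIf nz); rewrite mul0r.
  have : (\sum_(i in st v0) a i * M i z) * M v0 w = (\sum_(i in st v0) a i * M i w) * M v0 z.
    by rewrite !mulr_suml; apply: eq_bigr => i iv; rewrite -!mulrA comm.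
  by rewrite w0 mul0r.
have le v0 w0 : M v0 w0 != 0 -> (#|st v0| <= #|st w0|)%N.
  move=> nz; apply: indep => a H z; case: (boolP (z \in st w0)) => [/H //|zw].
  by apply: (prop v0 a z w0) => //; [rewrite st_sym | apply/H/st_refl].
have eq_card v0 : #|st v0| = #|st (s v0)|.
  have S : (\sum_(v1 : V) #|st (s v1)| = \sum_(v1 : V) #|st v1|)%N.
    exact/esym/(reindex_inj sinj).
  apply/eqP; rewrite eqn_leq le //=.
  rewrite leqNgt; apply/negP => lt.
  have : (\sum_(v1 : V) #|st v1| < \sum_(v1 : V) #|st (s v1)|)%N.
    rewrite (bigD1 v0) //= [ltnRHS](bigD1 v0) //= -addSn leq_add //.
    by apply: leq_sum => v1 _; apply: le.
  by rewrite S ltnn.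
move=> y ys; apply/eqP; apply: contraT => ny.
rewrite eq_sym in ys; have [z wz zy] := undom _ _ ys.
have zw : z \in st (s v) by rewrite inE wz orbT.
have : (#|st v| <= #|[predD1 st (s v) & z]|)%N.
  apply: indep => a H.
  have w0 : \sum_(i in st v) a i * M i (s v) = 0.
    by apply: H; rewrite !inE eqxx /= andbT adj_neq.
  have out j : j \notin st (s v) -> \sum_(i in st v) a i * M i j = 0.
    by move=> js; apply: (prop v a j (s v)) => //; rewrite st_sym.
  move=> j; case: (eqVneq j z) => [->|jz].
    apply: (prop v a z y) => //; first by rewrite st_sym.
    case: (boolP (y \in st (s v))) => [yw|/out //].
    by apply: H; rewrite inE /= yw andbT; apply: contraNneq zy => ->; apply: st_refl.
  by case: (boolP (j \in st (s v))) => [jw|/out //]; apply: H; rewrite inE /= jz.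
by rewrite eq_card (cardD1 z (st _)) zw ltnn.
Qed.

(** An injective self-map of the finite set of edges is onto. *)
Lemma hom_bijection_aut (s : V -> V) : injective s ->
  (forall u v, e u v -> e (s u) (s v)) -> forall u v, e (s u) (s v) = e u v.
Proof.
move=> sinj sE u v; apply/idP/idP; last exact: sE.
pose E := [set p : V * V | e p.1 p.2]; pose f (p : V * V) := (s p.1, s p.2).
have finj : injective f by move=> [a b] [c d] [/sinj-> /sinj->].
have /eqP fE : f @: E == E.
  rewrite eqEcard card_imset // leqnn andbT; apply/subsetP => _ /imsetP[p pE ->].
  by move: pE; rewrite !inE => /sE.
move=> suv; have : f (u, v) \in f @: E by rewrite fE inE.
by rewrite (mem_imset E (u, v) finj) inE.
Qed.

End Monomial.

(** * Heisenberg quotients and exponents of commuting elements *)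

Section Homology.
Local Open Scope ring_scope.
Variable V : sgraph.
Local Notation e := (@adj V).
Local Notation letter := (V * bool)%type.
Local Notation G := (raag V).
Implicit Types (u v w : seq letter) (x y z : V) (g h k : G).

(* the central coordinate of the image of [w] in the Heisenberg group *)
Fixpoint wpairs y z w : int :=
  if w is c :: w' then (if c.1 == y then sgn c.2 * wexp z w' else 0) + wpairs y z w' else 0.

Lemma wpairs_cat y z u v : wpairs y z (u ++ v) = wpairs y z u + wpairs y z v + wexp y u * wexp z v.
Proof.
elim: u => [|c u IH] /=; first by rewrite wexp_nil; ring.
by rewrite IH wexp_cons wexp_cat; case: ifP => _; ring.
Qed.

Lemma wpairs_raag_eq y z u v : z \notin st y -> raag_eq e u v -> wpairs y z u = wpairs y z v.
Proof.
rewrite inE => /norP[zy nyz].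
elim=> [? ? [p q x b|p q x x' b c xx']|w|p q _ IH|p q w _ IH1 _ IH2] //; last by rewrite IH1.
- rewrite !wpairs_cat /= !wexp_cons /= sgnN.
  case: eqP => [->|_]; first by rewrite eq_sym (negPf zy); ring.
  by case: eqP => _; ring.
- rewrite !wpairs_cat /= !wexp_cons /=.
  have N : ~~ ((x == y) && (x' == z)) by apply: contra nyz => /andP[/eqP<- /eqP<-].
  have N' : ~~ ((x' == y) && (x == z)).
    by apply: contra nyz => /andP[/eqP<- /eqP<-]; rewrite adj_sym.
  by move: N N'; do 4 case: (_ == _) => //= ; rewrite // => _ _; ring.
Qed.

(** Compare the Heisenberg coordinates of [g * h] and [h * g]. *)
Lemma commute_gexp y z g h : commute g h -> z \notin st y ->
  gexp y g * gexp z h = gexp z g * gexp y h.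
Proof.
move=> gh zy.
have : wpairs y z (wd g ++ wd h) = wpairs y z (wd h ++ wd g).
  by apply: wpairs_raag_eq => //; apply/elP; rewrite !el_cat !wdK.
rewrite !wpairs_cat (addrC (wpairs y z (wd h))) => /addrI ->.
exact: mulrC.
Qed.

End Homology.


(** * Automorphisms *)

Section Substitution.
Variables V W : sgraph.
Implicit Types (p q : V -> word W) (u v w : word V).

Lemma subst_cons p c w :
  subst p (c :: w) = (if c.2 then inv_word (p c.1) else p c.1) ++ subst p w.
Proof. by []. Qed.

Lemma subst1 p c : subst p [:: c] = if c.2 then inv_word (p c.1) else p c.1.
Proof. by rewrite subst_cons cats0. Qed.

Lemma subst_cat p u v : subst p (u ++ v) = subst p u ++ subst p v.
Proof. by rewrite /subst map_cat flatten_cat. Qed.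

Lemma inv_word_cat (X : Type) (u v : word X) : inv_word (u ++ v) = inv_word v ++ inv_word u.
Proof. by rewrite /inv_word map_cat rev_cat. Qed.

Lemma subst_inv p w : subst p (inv_word w) = inv_word (subst p w).
Proof.
elim: w => // c w IH; rewrite inv_word_cons -cats1 subst_cat IH subst1 subst_cons inv_word_cat.
rewrite /=; by case: c.2; rewrite //= inv_wordK.
Qed.

Lemma subst_raag_eq p u v : is_hom (@adj V) (@adj W) p ->
  raag_eq (@adj V) u v -> raag_eq (@adj W) (subst p u) (subst p v).
Proof.
move=> hp H; apply/elP.
elim: H => [? ? [s t x b|s t x y b c xy]|w|s t _ IH|s t w _ IH1 _ IH2] //; last by rewrite IH1.
- rewrite !subst_cat !subst_cons /= !el_cat.
  by case: b => /=; rewrite el_inv ?mulKg ?mulVKg.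
- rewrite !subst_cat !subst_cons /= !el_cat; congr (_ * _)%g; rewrite !mulgA; congr (_ * _)%g.
  have C : commute (el (p x)) (el (p y)).
    by rewrite /commute -!el_cat; apply/elP/hp.
  have CV (g h : raag W) : commute g h -> commute g^-1%g h.
    by move=> gh; apply: commute_sym; apply: commuteV; apply: commute_sym.
  by case: b; case: c => /=; rewrite ?el_inv; do ?[apply: CV | apply: commuteV]; apply: C.
Qed.

End Substitution.

Section Automorphisms.
Variable V : sgraph.
Local Notation e := (@adj V).
Implicit Types (p q : V -> word V) (u w : word V) (v x y z : V).

Lemma subst_comp p q w : subst (aut_comp p q) w = subst p (subst q w).
Proof.
elim: w => // c w IH; rewrite !subst_cons subst_cat IH /aut_comp.
by case: c.2; rewrite ?subst_inv.
Qed.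

Lemma subst_id w : subst (fun v => [:: (v, false)]) w = w.
Proof. by elim: w => // -[x b] w IH; rewrite subst_cons IH; case: b. Qed.

Lemma is_hom_comp p q : is_hom e e p -> is_hom e e q -> is_hom e e (aut_comp p q).
Proof.
move=> hp hq x y xy; rewrite /aut_comp -!subst_cat; apply: subst_raag_eq => //.
exact: hq.
Qed.

Lemma subst_retract p q : (forall v, raag_eq e (subst p (q v)) [:: (v, false)]) ->
  forall w, raag_eq e (subst p (subst q w)) w.
Proof.
move=> pq w; rewrite -subst_comp -[X in raag_eq _ _ X]subst_id; apply/elP.
elim: w => // c w IH; rewrite !subst_cons !el_cat IH; congr (_ * _)%g.
by have /elP E := pq c.1; case: c.2; rewrite ?el_inv /aut_comp E.
Qed.

Lemma is_aut_comp p q : is_aut e p -> is_aut e q -> is_aut e (aut_comp p q).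
Proof.
move=> [hp [p' [hp' pp']]] [hq [q' [hq' qq']]]; split; first exact: is_hom_comp.
exists (aut_comp q' p'); split=> [|v]; first exact: is_hom_comp.
rewrite !subst_comp /aut_comp; split.
  apply: (@raag_eq_trans V (subst p (p' v))); last by case: (pp' v).
  by apply: subst_raag_eq => //; apply: subst_retract => x; case: (qq' x).
apply: (@raag_eq_trans V (subst q' (q v))); last by case: (qq' v).
by apply: subst_raag_eq => //; apply: subst_retract => x; case: (pp' x).
Qed.

Local Open Scope ring_scope.

Lemma wexp_inv z w : wexp z (inv_word w) = - wexp z w.
Proof. by rewrite -gexp_el el_inv gexpV gexp_el. Qed.

Lemma wexp_subst p z w : wexp z (subst p w) = \sum_y wexp y w * wexp z (p y).
Proof.
elim: w => [|[x b] w IH].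
  by rewrite wexp_nil big1 // => y _; rewrite wexp_nil mul0r.
rewrite subst_cons wexp_cat IH /=.
under [RHS]eq_bigr do rewrite wexp_cons mulrDl /=.
rewrite big_split /=; congr (_ + _); rewrite (bigD1 x) //= eqxx big1 ?addr0.
  by case: b; rewrite ?wexp_inv ?mulN1r ?mul1r.
by move=> y; rewrite eq_sym => /negPf->; rewrite mul0r.
Qed.

Lemma wexp1 z x : wexp z [:: (x, false)] = (z == x)%:R.
Proof. by rewrite wexp_cons wexp_nil addr0 eq_sym; case: eqP. Qed.

(** Over the rationals the matrix is monomial. Its permutation [s] preserves adjacency, as otherwise
    [commute_gexp] would make a product of two non-zero entries vanish, so rigidity makes it the
    identity. The diagonal entries are integers with integral inverses. *)
Lemma aut_exponents p : undominated V -> rigid_graph e -> is_aut e p ->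
  exists s : V -> bool, forall v x, wexp x (p v) = if x == v then sgn (s v) else 0.
Proof.
move=> undom rigid [hp [q [hq pq]]].
have MN (i k : V) : \sum_j wexp j (p i) * wexp k (q j) = (i == k)%:R.
  by rewrite -wexp_subst (wexp_raag_eq _ (pq i).2) wexp1 eq_sym.
pose toQ (n : int) : rat := n%:~R.
have [|a v z b uv wz|s sinj [s1 s0]] := @monomial_of_commuting V rat
    (fun v x => toQ (wexp x (p v))) (fun v x => toQ (wexp x (q v))) undom.
- move=> i k; have := congr1 toQ (MN i k); rewrite /toQ rmorph_sum /= => E.
  under eq_bigr do rewrite -rmorphM; rewrite E; by case: (i == k).
- rewrite /toQ -!rmorphM /=; congr (_%:~R); rewrite -!gexp_el; apply: commute_gexp => //.
  move: uv; rewrite inE => /orP[/eqP->//|vu]; rewrite /commute -!el_cat.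
  by apply/elP/hp; rewrite adj_sym.
have toQ0 n : (toQ n == 0) = (n == 0) by rewrite /toQ intr_eq0.
have sE (u v : V) : e u v -> e (s u) (s v).
  move=> uv; apply: contraT => nE.
  have nst : s v \notin st (s u).
    rewrite inE negb_or nE andbT; apply: contraTneq uv => /sinj->.
    by rewrite adj_irr.
  have C : commute (el (p u)) (el (p v)) by rewrite /commute -!el_cat; apply/elP/hp.
  have := commute_gexp C nst; rewrite !gexp_el.
  have /eqP : toQ (wexp (s v) (p u)) = 0.
    by apply: s0; apply: contraNneq nst => ->; apply: st_refl.
  rewrite toQ0 => /eqP->; rewrite mul0r => /eqP; rewrite mulf_eq0.
  by have := s1 u; have := s1 v; rewrite !toQ0 => /negPf-> /negPf->.
have sid v : s v = v by apply: rigid; [exact: injF_bij | exact: hom_bijection_aut].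
have off v (w : V) : w != v -> wexp w (p v) = 0.
  by move=> wv; apply/eqP; rewrite -toQ0; apply/eqP/s0; rewrite sid.
exists (fun v => wexp v (p v) == -1) => v w; case: (eqVneq w v) => [->|/off //].
have := MN v v; rewrite (bigD1 v) //= big1 ?addr0 ?eqxx; last first.
  by move=> j jv; rewrite off ?mul0r.
move=> E; rewrite /sgn; case: eqP => // N.
have /orP[/eqP->//|/eqP/N//] : wexp v (p v) \is a GRing.unit.
by apply/unitrPr; exists (wexp v (q v)).
Qed.

Lemma is_psa_of_exponents p : undominated V -> is_aut e p ->
  (forall v x, wexp x (p v) = (x == v)%:R) -> is_psa e p.
Proof.
move=> undom ap pE; split=> // v; have [hp _] := ap.
have [|z vz|k kE] := @conj_of_exponents V (el (p v)) v undom.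
- by rewrite gexp_el pE eqxx.
- rewrite gexp_el pE; split; first by rewrite eq_sym (negPf (adj_neq vz)).
  exists (el (p z)); last by rewrite gexp_el pE eqxx.
  by rewrite /commute -!el_cat; apply/elP/hp.
exists (wd k); apply/elP; rewrite kE el_cat el_cons el_inv wdK.
by rewrite !mulgA.
Qed.

(** These sign changes serve as the finitely many coset representatives; each is its own inverse. *)
Definition flip (f : {ffun V -> bool}) v : word V := [:: (v, f v)].

Lemma flipK f v : subst (flip f) (flip f v) = [:: (v, false)].
Proof. by rewrite subst1 /flip /=; case: (f v). Qed.

Lemma is_aut_flip f : is_aut e (flip f).
Proof.
have H : is_hom e e (flip f).
  by move=> x y xy; apply/rst_step/(raag_comm [::] [::]).
split=> //; exists (flip f); split=> // v; rewrite flipK.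
by split; apply: raag_eq_refl.
Qed.

Lemma PSO_finite_indexP : undominated V -> rigid_graph e -> PSO_finite_index e.
Proof.
move=> undom rigid; exists #|{ffun V -> bool}|, (fun i => flip (enum_val i)).
split=> [i|p ap]; first exact: is_aut_flip.
have [s sE] := aut_exponents undom rigid ap.
pose f := [ffun v => s v]; exists (enum_rank f), (aut_comp (flip f) p).
rewrite enum_rankK; split.
  apply: is_psa_of_exponents => //; first exact/is_aut_comp/ap/is_aut_flip.
  move=> v w; rewrite /aut_comp wexp_subst (bigD1 v) //= big1 ?addr0.
    rewrite sE eqxx /flip wexp_cons wexp_nil /= addr0 ffunE eq_sym.
    by case: eqP => // _; case: (s v).
  by move=> y yv; rewrite sE (negPf yv) mul0r.
move=> v; rewrite /aut_comp -subst_comp.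
suff -> : subst (aut_comp (flip f) (flip f)) (p v) = subst (fun v => [:: (v, false)]) (p v).
  by rewrite subst_id; apply: raag_eq_refl.
by elim: (p v) => // c w IH; rewrite !subst_cons IH /aut_comp flipK.
Qed.

End Automorphisms.

(** * The isomorphism with the outer pure symmetric group *)

Section Realization.
Variables (L V : sgraph) (iota : L -> V) (C : {pred V}).
Local Notation e := (@adj V).
Local Notation Lam := [pred v in codom iota].
Hypothesis cut : cut_graph C Lam.
Hypothesis iota_inj : injective iota.
Hypothesis iota_adj : forall l l', e (iota l) (iota l') = adj l l'.
Hypothesis cut_link : forall u v l, u \in C -> v \notin C -> e u v -> e v (iota l).
Hypothesis cut_link_center : forall x,
  (forall u v, u \in C -> v \notin C -> e u v -> x \in st v) -> x \in Lam.
Hypothesis cut_center : forall x, exists2 v, v \notin C & x \notin st v.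

Let emb (l : L) : word V := [:: (iota l, false)].
(** The retraction killing all vertices outside the copy of [L]; it shows that [emb] is injective on
    group elements. *)
Let retr (v : V) : word L := if [pick l | iota l == v] is Some l then [:: (l, false)] else [::].

Lemma retr_emb w : subst retr (subst emb w) = w.
Proof.
elim: w => // -[l b] w IH; rewrite subst_cons subst_cat IH /=.
have E : retr (iota l) = [:: (l, false)].
  rewrite /retr; case: pickP => [l' /eqP/iota_inj->//|/(_ l)].
  by rewrite eqxx.
by case: b; rewrite ?subst_inv subst1 /= E.
Qed.

Lemma emb_hom : is_hom (@adj L) e emb.
Proof. by move=> x y xy; apply/rst_step/(raag_comm [::] [::]); rewrite iota_adj. Qed.

Lemma retr_hom : is_hom e (@adj L) retr.
Proof.
move=> x y; rewrite /retr; case: pickP => [l /eqP<-|_ _]; last by rewrite cats0; apply: raag_eq_refl.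
case: pickP => [l' /eqP<-|_ _]; last by rewrite cats0; apply: raag_eq_refl.
by rewrite iota_adj => ll; apply/rst_step/(raag_comm [::] [::]).
Qed.

Lemma all_emb w : all (fun c => c.1 \in Lam) (subst emb w).
Proof.
elim: w => // -[l b] w IH; rewrite subst_cons all_cat IH andbT.
by case: b; rewrite /= inE codom_f.
Qed.

Lemma sgp_emb (g : raag V) : g \in sgp Lam -> exists w, g = el (subst emb w).
Proof.
rewrite inE -{2}(wdK g); elim: (wd g) => [_|[x b] w IH] /=; first by exists [::].
case/andP; rewrite inE => /codomP[l ->] /IH[w' E]; exists ((l, b) :: w').
by rewrite subst_cons el_cat -E -[RHS]/(_ * _)%g el_cons; case: b.
Qed.

(* conjugation by the inverse of [w], so that [F] is a homomorphism and not an antihomomorphism *)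
Let F (w : word L) (v : V) : word V :=
  if v \in C then inv_word (subst emb w) ++ (v, false) :: subst emb w else [:: (v, false)].

Lemma el_F w v : el (F w v) =
  (if v \in C then (el (subst emb w))^-1 * gl (v, false) * el (subst emb w) else gl (v, false))%g.
Proof. by rewrite /F; case: ifP => // _; rewrite el_cat el_cons el_inv mulgA. Qed.

(** A vertex outside [C] with a neighbour in [C] is adjacent to all of the copy of [L], hence
    commutes with the conjugating element. *)
Lemma F_hom w : is_hom e e (F w).
Proof.
suff H x y : x \in C -> y \notin C -> e x y -> commute (el (F w x)) (el (F w y)).
  move=> x y xy; apply/elP; rewrite !el_cat.
  case: (boolP (x \in C)) (boolP (y \in C)) => xC [] yC.
  - rewrite !el_F xC yC -!mulgA !mulVKg; congr (_ * _)%g; rewrite !mulgA; congr (_ * _)%g.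
    exact: gl_comm.
  - exact: H.
  - by apply: commute_sym; apply: H; rewrite // adj_sym.
  - by rewrite !el_F (negPf xC) (negPf yC); apply: gl_comm.
move=> xC yC xy; rewrite !el_F xC (negPf yC).
have yw : commute (gl (y, false)) (el (subst emb w)).
  apply: sgp_st_comm; apply: el_sgp; apply: sub_all (all_emb w) => c.
  by rewrite inE => /codomP[l ->]; rewrite inE (cut_link _ xC yC xy) orbT.
apply: commute_sym; apply: commuteM => //; apply: commuteM; first exact: commuteV.
by apply: gl_comm; rewrite adj_sym.
Qed.

(** [C] is disjoint from the copy of [L], so the conjugating elements are themselves fixed; this is
    why [F] turns concatenation into composition. *)
Lemma subst_F_emb w u : subst (F w) (subst emb u) = subst emb u.
Proof.
elim: u => // -[l b] u IH; rewrite subst_cons subst_cat IH /=.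
suff E : F w (iota l) = [:: (iota l, false)] by case: b; rewrite ?subst_inv subst1 /= E.
rewrite /F; case: ifP => // lC; have := cut_far cut _ lC.
by move/(_ (iota l)); rewrite st_refl => /(_ (codom_f _ _)).
Qed.

Lemma F_comp w1 w2 v : F (w1 ++ w2) v = aut_comp (F w1) (F w2) v.
Proof.
rewrite /aut_comp {1 3}/F; case: ifP => vC; last by rewrite subst1 /= /F vC.
rewrite !subst_cat subst_inv subst_F_emb subst_cons subst_F_emb /= /F vC inv_word_cat.
by rewrite -!catA.
Qed.

Lemma F_nil v : F [::] v = [:: (v, false)].
Proof. by rewrite /F; case: ifP. Qed.

Lemma F_raag_eq w1 w2 : raag_eq (@adj L) w1 w2 -> aut_eq e (F w1) (F w2).
Proof.
move=> E v; apply/elP; rewrite !el_F.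
by have /elP-> := subst_raag_eq emb_hom E.
Qed.

Lemma F_psa w : is_psa e (F w).
Proof.
split=> [|v]; last first.
  rewrite /F; case: ifP => _; last by exists [::]; apply: raag_eq_refl.
  exists (inv_word (subst emb w)); rewrite inv_wordK; exact: raag_eq_refl.
split; first exact: F_hom.
exists (F (inv_word w)); split=> [|v]; first exact: F_hom.
rewrite -!/(aut_comp _ _ v) -!F_comp -(F_nil v).
by split; apply: F_raag_eq; [exact: raag_eq_inv_wordr | exact: raag_eq_inv_wordl].
Qed.

(** The inner factor centralises every vertex outside [C], so it is trivial by [cut_center]. Then
    [g1 * g2^-1] centralises a vertex [u] of [C], while its letters lie in [Lam], which misses the
    star of [u]. *)
Lemma F_inj w1 w2 : out_eq e (F w1) (F w2) -> raag_eq (@adj L) w1 w2.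
Proof.
case=> c H; have {}H v : el (F w1 v) = (el c * el (F w2 v) * (el c)^-1)%g.
  by have /elP := H v; rewrite !el_cat el_inv mulgA.
have c1 : el c = 1%g.
  apply: len0; apply/eqP; rewrite size_eq0; case E: (wd (el c)) => [|a w] //.
  have [v vC va] := cut_center a.1.
  have : el c \in sgp (st v).
    apply: (@cent_gl V (v, false)); have := H v; rewrite !el_F (negPf vC) => Hv.
    by rewrite /commute {1}Hv mulgVK.
  by rewrite inE E /= (negPf va).
have [u uC] := cut_nonempty cut.
have := H u; rewrite c1 invg1 mulg1 mul1g !el_F uC.
set g1 := el (subst emb w1); set g2 := el (subst emb w2) => E.
have gu : (g1 * g2^-1)%g \in sgp (st u).
  apply: (@cent_gl V (u, false)).
  have E' : (gl (u, false) * g1 = g1 * (g2^-1 * gl (u, false) * g2))%g.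
    by rewrite -E -!mulgA mulVKg.
  by rewrite /commute mulgA E' -!mulgA mulgV mulg1.
have gL : (g1 * g2^-1)%g \in sgp Lam by rewrite sgpM ?sgpV //; apply: el_sgp; apply: all_emb.
have g12 : (g1 * g2^-1)%g = 1%g.
  apply: len0; apply/eqP; rewrite size_eq0; case W: (wd _) => [|a w] //.
  move: gu gL; rewrite !inE W /= => /andP[au _] /andP[aL _].
  by have := cut_far cut aL uC; rewrite st_sym au.
have /elP : g1 = g2 by apply: divg1_eq.
by move/(subst_raag_eq retr_hom); rewrite !retr_emb.
Qed.

(** By [section_rigid] the automorphism conjugates [C] by [A] and the rest by [B]. Up to conjugation
    by [B] it conjugates [C] by [B^-1 * A], whose letters lie in all boundary stars and hence in
    [Lam]. *)
Lemma F_surj p : is_psa e p -> exists w, out_eq e p (F w).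
Proof.
move=> [[hp _] conj_p].
have [c cE] : exists c : V -> raag V, forall v, (el (p v) = c v * gl (v, false) * (c v)^-1)%g.
  have H v : exists c : raag V, (el (p v) = c * gl (v, false) * c^-1)%g.
    by have [c /elP E] := conj_p v; exists (el c); rewrite E el_cat el_cons el_inv mulgA.
  exact: (fin_all_exists H).
have sec : section c.
  move=> u v uv; apply: (@commute_conj_common V (u, false) (v, false)) => //.
  by rewrite -!cE /commute -!el_cat; apply/elP/hp.
have [A [B [AB BA]]] := section_rigid cut sec.
have pE v : el (p v) =
   ((if v \in C then A else B) * gl (v, false) * (if v \in C then A else B)^-1)%g.
  rewrite cE; move: (AB v); set X := if _ then _ else _ => XC.
  have := sgp_st_comm (a := (v, false)) XC; rewrite /commute => E.
  have -> : c v = (X * (X^-1 * c v))%g by rewrite mulVKg.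
  move: (_ * c v)%g E => t E.
  by rewrite -(mulgA X t) -E invgM !mulgA mulgK.
have BAL : (B^-1 * A)%g \in sgp Lam.
  rewrite inE; apply/allP => d dBA; apply: cut_link_center => u v uC vC uv.
  by have := BA u v uC vC uv; rewrite inE => /allP; apply.
have [w wE] := sgp_emb BAL.
exists (inv_word w), (wd B) => v; apply/elP; rewrite !el_cat el_inv wdK el_F pE.
case: (v \in C); last by rewrite mulgA.
rewrite subst_inv el_inv -wE invgK !invgM invgK !mulgA mulgV mul1g.
by rewrite -!mulgA mulgV mulg1.
Qed.

Lemma raag_iso_PSOP : raag_iso_PSO (@adj L) e.
Proof.
exists F; split; first exact: F_psa.
split=> [w1 w2|].
  exists [::] => v; rewrite F_comp /= cats0; exact: raag_eq_refl.
split=> [w1 w2|]; last exact: F_surj.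
split; last exact: F_inj.
by move/F_raag_eq=> H; exists [::] => v; rewrite /= cats0.
Qed.

End Realization.


(** * The graph *)

Section Construction.
Variable L : sgraph.

(** The unequal numbers 2 and 3 give the two gates different degrees and tell the ends of the rim
    apart. *)
Definition slot : Type := ('I_2 + L + 'I_3)%type.
HB.instance Definition _ := Finite.on slot.

(* The rim is a path of slots joined to the hub, every slot carries a spoke, and the gates
   are joined by the path [Gate false - Inner false - Inner true - Gate true].  The spokes at
   the vertices of [L] form a copy of [L] and see both gates, the 2 + 3 other ones see one
   gate only.  The two [Inner] vertices are the piece cut off by the spokes of [L]. *)
Inductive vtx := Hub | Gate of bool | Inner of bool | Rim of slot | Spoke of slot.

Definition vtx_enc v : unit + bool + bool + slot + slot :=
  match v with
  | Hub => inl (inl (inl (inl tt)))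
  | Gate b => inl (inl (inl (inr b)))
  | Inner b => inl (inl (inr b))
  | Rim t => inl (inr t)
  | Spoke t => inr t
  end.
Definition vtx_dec (c : unit + bool + bool + slot + slot) : vtx :=
  match c with
  | inl (inl (inl (inl _))) => Hub
  | inl (inl (inl (inr b))) => Gate b
  | inl (inl (inr b)) => Inner b
  | inl (inr t) => Rim t
  | inr t => Spoke t
  end.
Lemma vtx_encK : cancel vtx_enc vtx_dec. Proof. by case. Qed.
HB.instance Definition _ := Finite.copy vtx (can_type vtx_encK).

Definition linked (b : bool) (t : slot) : bool :=
  match t with inl (inl _) => ~~ b | inl (inr _) => true | inr _ => b end.

Definition slot_adj (s t : slot) : bool :=
  match s, t with inl (inr l), inl (inr l') => adj l l' | _, _ => false end.

Definition rk (l : L) : nat := enum_rank l.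
Arguments rk : simpl never.

Lemma rk_inj : injective rk. Proof. by move=> l l' /val_inj/enum_rank_inj. Qed.
Lemma rk_lt l : rk l < #|L|. Proof. exact: ltn_ord. Qed.
Lemma rk_surj k : k < #|L| -> exists l, rk l = k.
Proof. by move=> kn; exists (enum_val (Ordinal kn)); rewrite /rk enum_valK. Qed.

Definition pos (t : slot) : nat :=
  match t with
  | inl (inl i) => i
  | inl (inr l) => 2 + rk l
  | inr j => 2 + #|L| + j
  end.

Definition consec s t := (pos s == (pos t).+1) || (pos t == (pos s).+1).

Definition vadj (u v : vtx) : bool :=
  match u, v with
  | Hub, Rim _ | Rim _, Hub => true
  | Rim s, Rim t => consec s t
  | Rim s, Spoke t | Spoke t, Rim s => s == t
  | Spoke s, Spoke t => slot_adj s t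
  | Spoke t, Gate b | Gate b, Spoke t => linked b t
  | Gate b, Inner b' | Inner b', Gate b => b == b'
  | Inner b, Inner b' => b != b'
  | _, _ => false
  end.

Lemma vadj_sym : symmetric vadj.
Proof.
move=> [|b|b|s|s] [|b'|b'|t|t] //=; first by rewrite eq_sym.
  by rewrite /consec orbC.
by case: s => [[i|l]|j]; case: t => [[i'|l']|j'] //=; rewrite adj_sym.
Qed.

Lemma vadj_irr : irreflexive vadj.
Proof.
move=> [|b|b|s|s] //=; first by rewrite eqxx.
  by rewrite /consec; lia.
by case: s => [[i|l]|j] //=; rewrite adj_irr.
Qed.

Definition wheel : sgraph := SGraph vadj_sym vadj_irr.

Local Notation e := (@adj wheel).

Lemma wadjE (u v : wheel) : e u v = vadj u v. Proof. by []. Qed.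

Lemma Rim_inj : injective Rim. Proof. by move=> s t []. Qed.
Lemma Spoke_inj : injective Spoke. Proof. by move=> s t []. Qed.

Lemma vtx_eqE (u v : vtx) : (u == v) =
  match u, v with
  | Hub, Hub => true
  | Gate b, Gate b' | Inner b, Inner b' => b == b'
  | Rim s, Rim t | Spoke s, Spoke t => s == t
  | _, _ => false
  end.
Proof.
by apply/eqP/idP => [->|]; [case: v | case: u v => [|b|b|s|s] [|b'|b'|t|t] // /eqP->].
Qed.

Lemma wstE (u v : wheel) : (v \in st u) = (v == u :> vtx) || vadj u v.
Proof. by []. Qed.

Definition lam (l : L) : wheel := Spoke (inl (inr l)).
Definition piece : {pred wheel} := [pred v : vtx | if v is Inner _ then true else false].

Lemma lam_inj : injective lam. Proof. by move=> l l' []. Qed.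

Definition tip (b : bool) : slot := if b then inr ord0 else inl (inl ord0).

Lemma linked_tip b b' : linked b (tip b') = (b == b').
Proof. by case: b'; case: b. Qed.

Lemma far_slot s : exists t, t != s /\ ~~ consec s t.
Proof.
case: (leqP 2 (pos s)) => H.
  exists (tip false); split; last by rewrite /consec /=; lia.
  by apply: contraTneq H => <-.
exists (inr ord_max); split; last by rewrite /consec /=; lia.
by apply: contraTneq H => <- /=; lia.
Qed.

Lemma wheel_undominated : undominated wheel.
Proof.
move=> [|b|b|t|t] y xy.
- case: y xy => // [b|b|s|s] _; try by exists (Rim (tip false)); rewrite ?wstE.
    have [t [ts ns]] := far_slot s; exists (Rim t) => //.
    by rewrite wstE vtx_eqE (negPf ts).
  have [t [ts ns]] := far_slot s; exists (Rim t) => //.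
- case: y xy => [|b'|b'|s|s] xy; try by exists (Inner b); rewrite ?wadjE ?wstE /= ?eqxx.
    exists (Inner b); rewrite ?wadjE ?wstE /= ?eqxx //.
    by apply: contraNneq xy => <-; rewrite eqxx.
  by exists (Spoke (tip b)); rewrite ?wadjE ?wstE /= ?linked_tip.
- case: y xy => [|b'|b'|s|s] xy; try by exists (Inner (~~ b)); rewrite ?wadjE ?wstE //=; case: (b).
    case: (eqVneq b b') => [<-|bb]; first by exists (Inner (~~ b)); rewrite ?wadjE ?wstE //=; case: (b).
    by exists (Gate b); rewrite ?wadjE ?wstE ?vtx_eqE /= ?eqxx ?orbF.
  by exists (Gate b); rewrite ?wadjE ?wstE ?vtx_eqE /= ?eqxx // eq_sym; rewrite vtx_eqE in xy.
- case: y xy => [|b'|b'|s|s] xy; try by exists Hub.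
    by exists (Spoke t); rewrite ?wadjE ?wstE /=.
  exists (Spoke t); rewrite ?wadjE ?wstE /= ?eqxx //.
  by rewrite vtx_eqE eq_sym in xy.
- have [b bt] : exists b, linked b t by case: t {xy} => [[i|l]|j]; [exists false|exists true|exists true].
  case: y xy => [|b'|b'|s|s] xy; try by exists (Rim t); rewrite ?wadjE ?wstE /= ?eqxx.
  + by exists (Gate b).
  + by exists (Gate b).
Qed.

Local Notation Lam := [pred v in codom lam].

Lemma LamE (t : slot) : ((Spoke t : wheel) \in Lam) = if t is inl (inr _) then true else false.
Proof.
rewrite inE; case: t => [[i|l]|j]; last 1 first.
- by apply/codomP => -[].
- by apply/codomP => -[].
- by apply/codomP; exists l.
Qed.

Lemma nLam (v : wheel) : v \in Lam -> exists l, v = lam l.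
Proof. by rewrite inE => /codomP. Qed.

(** The star of a vertex outside [Lam] contains at most one gate, so the [Inner] vertices are not
    cut off. Every remaining vertex is joined to [Inner false] or to [Hub] by a path. *)
Lemma wheel_conn (x : wheel) (f : wheel -> bool) : x \notin Lam -> star_constant x f ->
  forall u v, u \notin st x -> v \notin st x -> f u = f v.
Proof.
move=> xL fc.
suff [c H] : exists c, forall u, u \notin st x -> f u = c.
  by move=> u v ux vx; rewrite !H.
have link t : exists b, linked b t by case: t => [[i|l]|j]; [exists false|exists true|exists true].
(* One propagation rule for each kind of edge that the paths use. *)
have AA b : Inner b \notin st x -> Inner (~~ b) \notin st x -> f (Inner b) = f (Inner (~~ b)).
  by move=> *; apply: fc; rewrite ?wadjE //=; case: (b).
have KA b : Gate b \notin st x -> Inner b \notin st x -> f (Gate b) = f (Inner b).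
  by move=> *; apply: fc; rewrite ?wadjE //=.
have YK b t : linked b t -> Spoke t \notin st x -> Gate b \notin st x -> f (Spoke t) = f (Gate b).
  by move=> *; apply: fc; rewrite ?wadjE //=.
have PY t : Rim t \notin st x -> Spoke t \notin st x -> f (Rim t) = f (Spoke t).
  by move=> *; apply: fc; rewrite ?wadjE //=.
have PH t : Rim t \notin st x -> Hub \notin st x -> f (Rim t) = f Hub.
  by move=> *; apply: fc; rewrite ?wadjE //=.
case: x xL {fc} AA KA YK PY PH => [|b|b|t|t] xL AA KA YK PY PH.
- exists (f (Inner false)).
  have HA b : f (Inner b) = f (Inner false) by case: b; rewrite // (AA true).
  have HK b : f (Gate b) = f (Inner false) by rewrite KA.
  case=> [|b|b|t|t] // ux; have [b bt] := link t; rewrite (YK b) //.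
- exists (f Hub).
  have HP t : f (Rim t) = f Hub by rewrite PH.
  have HY t : ~~ linked b t -> f (Spoke t) = f Hub by move=> nt; rewrite -PY.
  have HK : f (Gate (~~ b)) = f Hub.
    have nt : ~~ linked b (tip (~~ b)) by rewrite linked_tip; case: (b).
    have nK : Gate (~~ b) \notin st (Gate b : wheel) by rewrite wstE vtx_eqE /=; case: (b).
    by rewrite -(YK _ (tip (~~ b))) ?linked_tip ?HY.
  case=> [|b'|b'|t|t] //; rewrite wstE vtx_eqE /= ?orbF => bb.
  + by have -> : b' = ~~ b by case: (b) b' bb => -[].
  + have -> : b' = ~~ b by case: (b) b' bb => -[].
    by rewrite -KA // wstE vtx_eqE /=; case: (b).
  + exact: HY.
- exists (f Hub).
  have HP t : f (Rim t) = f Hub by rewrite PH.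
  have HY t : f (Spoke t) = f Hub by rewrite -PY.
  case=> [|b'|b'|t|t] //; rewrite wstE vtx_eqE /= => bb.
    by rewrite -(YK _ (tip b')) ?linked_tip // wstE.
  by case: (b) b' bb => -[].
- exists (f (Inner false)).
  have HA b : f (Inner b) = f (Inner false) by case: b; rewrite // (AA true).
  have HK b : f (Gate b) = f (Inner false) by rewrite KA.
  have nY s : s != t -> Spoke s \notin st (Rim t : wheel) by rewrite wstE /= eq_sym.
  have HY s : s != t -> f (Spoke s) = f (Inner false).
    by move=> ts; have [b bs] := link s; rewrite (YK b) // nY.
  case=> [|b|b|s|s] // ux; last by apply: HY; rewrite wstE /= eq_sym in ux.
  have ts : s != t by apply: contraNneq ux => ->; apply: st_refl.
  by rewrite PY ?HY ?nY.
- rewrite LamE in xL; exists (f Hub).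
  have [b [bt nbt]] : exists b, linked b t /\ ~~ linked (~~ b) t.
    by case: t xL {AA KA YK PY PH} => [[i|l]|j] //; [exists false|exists true].
  have HP s : s != t -> f (Rim s) = f Hub by move=> ts; rewrite PH // wstE /=.
  have HY s : Spoke s \notin st (Spoke t : wheel) -> f (Spoke s) = f Hub.
    move=> ux; have ts : s != t by apply: contraNneq ux => ->; apply: st_refl.
    by rewrite -PY ?HP // wstE /=.
  have HK : f (Gate (~~ b)) = f Hub.
    have ts : tip (~~ b) != t by apply: contraNneq nbt => <-; rewrite linked_tip.
    have nY : Spoke (tip (~~ b)) \notin st (Spoke t : wheel).
      rewrite wstE vtx_eqE (negPf ts) /=.
      by case: t xL {AA KA YK PY PH bt nbt HP HY ts} => [[i|l]|j].
    by rewrite -(YK _ (tip (~~ b))) ?HY ?linked_tip.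
  have HA : f (Inner (~~ b)) = f Hub by rewrite -KA.
  case=> [|b'|b'|s|s] // ux; last by apply: HY.
  + suff -> : b' = ~~ b by [].
    by apply: contraNeq ux; rewrite wstE /=; case: b' b bt {nbt HK HA} => -[].
  + case: (eqVneq b' (~~ b)) => [->//|bb]; rewrite AA //.
    by have -> : ~~ b' = ~~ b by case: b' b bb {bt nbt HK HA ux} => -[].
  + by apply: HP; apply: contraNneq ux => ->; rewrite wstE /= eqxx.
Qed.

(** The star of [x] contains both gates; the other vertices left outside the piece reach [Hub] along
    the rim vertices. *)
Lemma wheel_conn2 (x : wheel) (f : wheel -> bool) : x \in Lam -> star_constant x f ->
  forall u v, u \notin st x -> v \notin st x -> (u \in piece) = (v \in piece) -> f u = f v.
Proof.
move=> /nLam[l ->] fc.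
have AA b : f (Inner b) = f (Inner true).
  by case: b => //; apply: fc.
have HH u : u \notin st (lam l) -> u \notin piece -> f u = f Hub.
  have HP s : s != inl (inr l) -> f (Rim s) = f Hub.
    by move=> sl; apply: fc; rewrite ?wstE ?wadjE.
  case: u => [|b|b|s|s] // ux _.
    by apply: HP; apply: contraNneq ux => ->; rewrite wstE /= eqxx.
  have sl : s != inl (inr l) by apply: contraNneq ux => ->; apply: st_refl.
  by rewrite -(HP s) //; apply: fc; rewrite ?wstE ?wadjE //=.
move=> u v ux vx; case: (boolP (u \in piece)) => uC; case: (boolP (v \in piece)) => vC // _.
  by case: u v uC vC {ux vx} => // b [] // b' _ _; rewrite !AA.
by rewrite !HH.
Qed.

Lemma wheel_cut : cut_graph piece Lam.
Proof.
split.
- exact: wheel_undominated.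
- exact: wheel_conn.
- exact: wheel_conn2.
- by exists (Inner true).
- by move=> x [|b|b|s|s] // /nLam[l ->].
- move=> x [|b|b|s|s] // [|b'|b'|t|t] // /nLam[l ->] _ _ _.
  exists (Spoke (tip b')); rewrite wadjE /= linked_tip eqxx; split=> //.
  by case: (b').
- case=> [|b|b|t|t].
  + by exists (Gate true), (Gate false).
  + by exists Hub, (Gate (~~ b)); split=> //; rewrite wstE vtx_eqE /=; case: (b).
  + by exists Hub, (Rim (tip true)).
  + by exists (Gate true), (Gate false).
  + have [s [st' _]] := far_slot t.
    by exists Hub, (Rim s); split=> //; rewrite wstE /=.
Qed.

Lemma wheel_link (u v : wheel) l : u \in piece -> v \notin piece -> e u v -> e v (lam l).
Proof. by case: u => // b _; case: v. Qed.

Lemma wheel_link_center (x : wheel) :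
  (forall u v, u \in piece -> v \notin piece -> e u v -> x \in st v) -> x \in Lam.
Proof.
move=> H; have xK b : x \in st (Gate b : wheel) by apply: (H (Inner b)) => //=; rewrite wadjE /= eqxx.
move: (xK true) (xK false); rewrite !wstE !vtx_eqE; case: x {H xK} => [|b|b|t|t] //=.
- by case: b.
- by case: b.
- by rewrite LamE; case: t => [[]|].
Qed.

Lemma wheel_center (x : wheel) : exists2 v, v \notin piece & x \notin st v.
Proof.
by case: x => [|b|b|t|t]; [exists (Gate true)|exists Hub|exists Hub|exists (Gate true)|exists Hub].
Qed.

End Construction.


(** * Rigidity of the graph *)

Section Rigidity.
Variable L : sgraph.
Local Notation vtx := (vtx L).
Local Notation slot := (slot L).
Local Notation Hub := (@Hub L).
Local Notation Gate := (@Gate L).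
Local Notation Inner := (@Inner L).
Local Notation Rim := (@Rim L).
Local Notation Spoke := (@Spoke L).
Local Notation e := (@vadj L).
Local Notation n := #|L|.
Implicit Types (u v : vtx) (s t : slot) (b : bool).

Definition deg v := #|[pred u | e v u]|.

Lemma deg_le v (r : seq vtx) : (forall u, e v u -> u \in r) -> deg v <= size r.
Proof.
move=> H; rewrite /deg cardE; apply: uniq_leq_size; first exact: enum_uniq.
by move=> u; rewrite mem_enum => /H.
Qed.

Lemma deg_ge v (r : seq vtx) : uniq r -> all (e v) r -> size r <= deg v.
Proof.
move=> ur /allP H; rewrite /deg cardE; apply: uniq_leq_size => // u /H.
by rewrite mem_enum.
Qed.

Lemma pos_inj : injective (@pos L).
Proof.
move=> [[i|l]|j] [[i'|l']|j']; rewrite /pos => E.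
- by congr (inl (inl _)); apply: val_inj.
- by have := ltn_ord i; lia.
- by have := ltn_ord i; lia.
- by have := ltn_ord i'; lia.
- by congr (inl (inr _)); apply: rk_inj; lia.
- by have := rk_lt l; lia.
- by have := ltn_ord i'; lia.
- by have := rk_lt l'; lia.
- by congr (inr _); apply: val_inj => /=; lia.
Qed.

Lemma pos_lt t : pos t < n + 5.
Proof.
case: t => [[i|l]|j]; rewrite /pos; first by have := ltn_ord i; lia.
  by have := rk_lt l; lia.
by have := ltn_ord j; lia.
Qed.

Lemma pos_surj k : k < n + 5 -> exists t, pos t = k.
Proof.
move=> kn; case: (ltnP k 2) => k2; first by exists (inl (inl (Ordinal k2))).
case: (ltnP k (2 + n)) => k3.
  have [|l lk] := @rk_surj L (k - 2); first by lia.
  by exists (inl (inr l)); rewrite /pos; lia.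
have kj : k - (2 + n) < 3 by lia.
by exists (inr (Ordinal kj)); rewrite /pos /nat_of_ord; lia.
Qed.

Lemma card_slot : #|{: slot}| = n + 5.
Proof. by rewrite /slot !card_sum !card_ord; lia. Qed.

Lemma deg_Hub : n + 5 <= deg Hub.
Proof.
rewrite -card_slot -(card_codom (@Rim_inj L)); apply: subset_leq_card.
by apply/subsetP => _ /codomP[t ->].
Qed.

Lemma deg_Rim t : deg (Rim t) <= 4.
Proof.
pose r := enum [pred s | consec t s].
apply: (@leq_trans (size ([:: Hub; Spoke t] ++ map Rim r))).
  apply: deg_le => -[|b|b|s|s] //=; rewrite ?inE ?vtx_eqE //=.
    by move=> ts; rewrite mem_map ?mem_enum //; apply: Rim_inj.
  by move=> /eqP->; rewrite eqxx.
rewrite size_cat size_map /= !ltnS.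
rewrite -(size_map (@pos L)) (_ : 2 = size [:: (pos t).+1; (pos t).-1]) //.
apply: uniq_leq_size; first by rewrite map_inj_uniq ?enum_uniq //; apply: pos_inj.
move=> k /mapP[s + ->]; rewrite mem_enum !inE /consec; lia.
Qed.

Lemma deg_Inner b : deg (Inner b) <= 2.
Proof.
apply: (@deg_le _ [:: Gate b; Inner (~~ b)]) => -[|b'|b'|s|s] //=; rewrite !inE !vtx_eqE.
  by move=> /eqP->; rewrite eqxx.
by rewrite orbC; case: b; case: b'.
Qed.

Definition lam_slots : seq slot := [seq inl (inr l) | l <- enum L].

Lemma mem_lam_slots l : inl (inr l) \in lam_slots.
Proof. by apply: map_f; rewrite mem_enum. Qed.

Lemma size_lam_slots : size lam_slots = n.
Proof. by rewrite size_map -cardE. Qed.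

Lemma deg_Gate b : deg (Gate b) <= n + 3 + b.
Proof.
pose ends : seq slot := if b then [seq inr j | j <- enum 'I_3] else [seq inl (inl i) | i <- enum 'I_2].
apply: (@leq_trans (size (Inner b :: map Spoke (lam_slots ++ ends)))).
  apply: deg_le => -[|b'|b'|s|s] //=; rewrite inE vtx_eqE.
    by move=> /eqP->; rewrite eqxx.
  move=> bs; rewrite mem_map; last exact: Spoke_inj.
  rewrite mem_cat /ends; case: s bs => [[i|l]|j]; rewrite ?mem_lam_slots //=.
    by case: b {ends} => // _; rewrite map_f ?mem_enum ?orbT.
  by case: b {ends} => // _; rewrite map_f ?mem_enum ?orbT.
rewrite /= size_map size_cat size_lam_slots /ends.
by case: b {ends}; rewrite /= size_map size_enum_ord; lia.
Qed.

Lemma deg_Gate_true : n + 4 <= deg (Gate true).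
Proof.
pose r : seq vtx := Inner true :: map Spoke (lam_slots ++ [seq inr j | j <- enum 'I_3]).
have -> : n + 4 = size r.
  by rewrite [in RHS]/= size_map size_cat size_lam_slots size_map size_enum_ord; lia.
apply: deg_ge.
  rewrite /r /= map_inj_uniq; last exact: Spoke_inj.
  rewrite (introN mapP) //=; last by case.
  have u1 : uniq lam_slots by rewrite map_inj_uniq ?enum_uniq // => l l' [].
  have u2 : uniq [seq (inr j : slot) | j <- enum 'I_3].
    by rewrite map_inj_uniq ?enum_uniq // => j j' [].
  rewrite cat_uniq u1 u2 andbT andTb.
  by apply/hasPn => _ /mapP[j _ ->]; apply/mapP => -[].
rewrite /= all_map; apply/allP => s; rewrite mem_cat => /orP[]/mapP[? _ ->] //.
Qed.

Lemma deg_Spoke t : deg (Spoke t) <= n + 3.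
Proof.
apply: (@leq_trans (size ([:: Rim t; Gate true; Gate false] ++ map Spoke lam_slots))).
  apply: deg_le => -[|b|b|s|s] //=; rewrite ?inE ?vtx_eqE //=.
  - by case: b.
  - by move=> /eqP->; rewrite eqxx.
  - case: s => [[i|l]|j]; case: t => [[i'|l']|j'] //= _.
    by rewrite mem_map ?mem_lam_slots //; apply: Spoke_inj.
by rewrite size_cat size_map size_lam_slots /=; lia.
Qed.

(** Degrees single out [Hub], and then [Gate true] among the vertices not adjacent to it. Rim and
    spokes are permuted by one map [sig] of slots, which preserves consecutive positions and the
    slots seen by each gate, and is therefore the identity. *)
Lemma wheel_rigid : rigid_graph e.
Proof.
move=> s sbij sE.
have sinj := bij_inj sbij.
have sdeg v : deg (s v) = deg v.
  rewrite /deg -(card_image (sinj) [pred u | e v u]).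
  have [s' sK s'Gate] := sbij.
  apply: eq_card => u; apply/idP/imageP => [|[u' vu ->]]; last by rewrite inE sE.
  by move=> H; exists (s' u); rewrite ?s'Gate // inE -sE s'Gate.
have sHub : s Hub = Hub.
  have := sdeg Hub; have := deg_Hub; case: (s Hub) => // [b|b|t|t].
  - by have := deg_Gate b; case: b; lia.
  - by have := deg_Inner b; lia.
  - by have := deg_Rim t; lia.
  - by have := deg_Spoke t; lia.
have sKt : s (Gate true) = Gate true.
  have := sdeg (Gate true); have := deg_Gate_true; have := sE Hub (Gate true).
  rewrite sHub; have := sinj Hub (Gate true); rewrite sHub.
  case: (s (Gate true)) => // [|b|b|t].
  - by move=> /(_ erefl).
  - by case: b => // _ _; have := deg_Gate false; lia.
  - by have := deg_Inner b; lia.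
  - by have := deg_Spoke t; lia.
have [sig sP] : exists sig : slot -> slot, forall t, s (Rim t) = Rim (sig t).
  apply: (@fin_all_exists _ _ (fun t t' => s (Rim t) = Rim t')) => t.
  by have := sE Hub (Rim t); rewrite sHub; case: (s (Rim t)) => // t' _; exists t'.
have sig_inj : injective sig.
  by move=> t t' E; apply: (@Rim_inj L); apply: sinj; rewrite !sP E.
have sY t : s (Spoke t) = Spoke (sig t).
  have := sE (Rim t) (Spoke t); rewrite sP /= eqxx; have := sinj Hub (Spoke t); rewrite sHub.
  have := sE Hub (Spoke t); rewrite sHub.
  by case: (s (Spoke t)) => // [_ /(_ erefl)//|t' _ _ /= /eqP->].
have sAt : s (Inner true) = Inner true.
  have := sE (Gate true) (Inner true); rewrite sKt /=.
  case E: (s (Inner true)) => [|b|b|t'|t'] //=; first by case: b E.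
  have [g _ Kg] := injF_bij sig_inj.
  by move=> _; have := sE (Inner true) (Rim (g t')); rewrite E sP Kg /= eqxx.
have sAf : s (Inner false) = Inner false.
  have := sE (Inner true) (Inner false); rewrite sAt /=.
  have := sinj (Inner false) (Gate true); rewrite sKt.
  by case: (s (Inner false)) => // -[] // /(_ erefl).
have sKf : s (Gate false) = Gate false.
  have := sE (Inner false) (Gate false); rewrite sAf /=.
  have := sinj (Gate false) (Inner true); rewrite sAt.
  by case: (s (Gate false)) => // -[] // /(_ erefl).
have sig_consec t t' : consec (sig t) (sig t') = consec t t'.
  by have := sE (Rim t) (Rim t'); rewrite !sP.
have sig_linked b t : linked b (sig t) = linked b t.
  by have := sE (Gate b) (Spoke t); rewrite sY; case: b; rewrite ?sKt ?sKf.
have pos01 t : ~~ linked true t -> pos t < 2.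
  by case: t => [[i|]|] //= _; apply: ltn_ord.
(* Positions 0 and 1 are those not seen by [Gate true]. If [sig] exchanged them, position 2 would
   have to go next to position 0, that is to position 1, which is already taken. *)
have sig0 t : pos t = 0 -> sig t = t.
  move=> t0.
  have tT : ~~ linked true t by case: t t0 => [[i|l]|j].
  have : pos (sig t) < 2 by apply: pos01; rewrite sig_linked.
  case: (posnP (pos (sig t))) => [E _|gt lt]; first by apply: pos_inj; rewrite E t0.
  have [t1 t1E] : exists t1, pos t1 = 1 by apply: pos_surj; lia.
  have [t2 t2E] : exists t2, pos t2 = 2 by apply: pos_surj; lia.
  have t1T : ~~ linked true t1 by case: t1 t1E => [[i|l]|j].
  have st1 : pos (sig t1) < 2 by apply: pos01; rewrite sig_linked.
  have ne : pos (sig t1) != pos (sig t).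
    by apply/eqP => /pos_inj/sig_inj E; rewrite E t0 in t1E.
  have : consec (sig t1) (sig t2) by rewrite sig_consec /consec t1E t2E.
  rewrite /consec => c12.
  have /pos_inj/sig_inj E : pos (sig t2) = pos (sig t) by lia.
  by rewrite E t0 in t2E.
(* The image of position [k + 1] is next to the fixed position [k], and position [k - 1] is already
   an image. *)
have sigK k : forall t, pos t <= k -> sig t = t.
  elim: k => [|k IH] t; first by rewrite leqn0 => /eqP/sig0.
  rewrite leq_eqVlt => /orP[/eqP tk|/IH //].
  have [r rk] : exists r : slot, pos r = k by apply: pos_surj; have := pos_lt t; lia.
  have := sig_consec t r; rewrite (IH r) ?rk // /consec tk rk eqxx /= => c.
  apply: pos_inj; rewrite tk; case/orP: c => /eqP // kE.
  have rs : sig t = sig (sig t) by rewrite (IH (sig t)) //; lia.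
  by have := sig_inj _ _ rs => E; move: tk; rewrite E; lia.
have sigE t : sig t = t by apply: (sigK (pos t)).
by case=> [|[]|[]|t|t] //; rewrite ?sP ?sY sigE.
Qed.

End Rigidity.


(** * The theorem *)

Section Relabel.
Variable W : sgraph.

Definition ord_adj : rel 'I_#|W| := fun i j => adj (enum_val i) (enum_val j).

Lemma ord_adj_sym : symmetric ord_adj.
Proof. by move=> i j; apply: adj_sym. Qed.

Lemma ord_adj_irr : irreflexive ord_adj.
Proof. by move=> i; apply: adj_irr. Qed.

Definition ord_graph : sgraph := SGraph ord_adj_sym ord_adj_irr.
Local Notation V := ord_graph.

Definition vl (i : V) : W := enum_val i.
Definition lv (x : W) : V := enum_rank x.

Lemma vlK : cancel vl lv. Proof. exact: enum_valK. Qed.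
Lemma lvK : cancel lv vl. Proof. exact: enum_rankK. Qed.

Lemma adj_vl (i j : V) : adj i j = adj (vl i) (vl j). Proof. by []. Qed.

Lemma st_vl (i j : V) : (i \in st j) = (vl i \in st (vl j)).
Proof. by rewrite !inE adj_vl (can_eq vlK). Qed.

Lemma ord_graph_rigid : rigid_graph (@adj W) -> rigid_graph (@adj V).
Proof.
move=> rig s [s' sK s'K] sE i.
have := rig (vl \o s \o lv) _ _ (vl i); rewrite /= vlK => H; apply: (can_inj vlK).
apply: H => [|a b]; last by rewrite /= -adj_vl sE adj_vl !lvK.
by exists (vl \o s' \o lv) => x /=; rewrite vlK ?sK ?s'K lvK.
Qed.

Lemma ord_graph_cut (C Lam : {pred W}) (Lam' : {pred V}) :
  (forall i, (i \in Lam') = (vl i \in Lam)) ->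
  cut_graph C Lam -> cut_graph [pred i : V | vl i \in C] Lam'.
Proof.
move=> LamE [undom conn conn2 [q qC] far bd rest].
have fc i (f : V -> bool) : star_constant i f -> star_constant (vl i) (f \o lv).
  by move=> H x y xi yi xy; apply: H; rewrite ?st_vl ?adj_vl ?lvK.
split.
- move=> x y xy; have [|z xz zy] := undom (vl x) (vl y); first by rewrite (can_eq vlK).
  by exists (lv z); rewrite ?adj_vl ?st_vl ?lvK.
- move=> x f; rewrite LamE => xL /fc H u v; rewrite !st_vl => ux vx.
  by have := conn _ _ xL H _ _ ux vx; rewrite /= !vlK.
- move=> x f; rewrite LamE => xL /fc H u v; rewrite !st_vl !inE => ux vx uv.
  by have := conn2 _ _ xL H _ _ ux vx uv; rewrite /= !vlK.
- by exists (lv q); rewrite inE lvK.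
- by move=> x u; rewrite LamE st_vl inE; apply: far.
- move=> x u v; rewrite LamE !inE adj_vl => xL uC vC uv.
  have [r [vr rx rC]] := bd _ _ _ xL uC vC uv.
  exists (lv r); split; rewrite ?adj_vl ?st_vl ?lvK //.
  by rewrite inE /= lvK.
- move=> x; have [r [s [rs rx sx rC sC]]] := rest (vl x).
  exists (lv r), (lv s); split; rewrite ?(can_eq lvK) ?st_vl ?lvK //.
  all: by rewrite inE /= lvK.
Qed.

End Relabel.

Theorem theorem3p5 (L : finType) (eL : rel L) :
  simple_graph eL ->
  exists (n : nat) (e : rel 'I_n),
    [/\ simple_graph e,
        raag_iso_PSO eL e,
        PSO_finite_index e &
        rigid_graph e].
Proof.
case=> Lsym Lirr; pose G := SGraph Lsym Lirr; pose W := wheel G; pose V := ord_graph W.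
pose io (l : G) : V := lv (lam l).
have LamE (i : V) : (i \in [pred v in codom io]) = (vl i \in [pred v in codom (@lam G)]).
  rewrite !inE; apply/codomP/codomP => -[l E]; exists l; first by rewrite E lvK.
  by apply: (can_inj (@vlK W)); rewrite E lvK.
have cut := ord_graph_cut LamE (wheel_cut G).
have rig := @ord_graph_rigid W (@wheel_rigid G).
exists #|W|, (@ord_adj W); split=> //.
- by split; [apply: ord_adj_sym | apply: ord_adj_irr].
- apply: (@raag_iso_PSOP G V io _ cut).
  + by move=> l l' /(can_inj (@lvK W))/lam_inj.
  + by move=> l l'; rewrite adj_vl !lvK.
  + by move=> u v l; rewrite !inE !adj_vl lvK; apply: wheel_link.
  + move=> x H; rewrite LamE; apply: wheel_link_center => u v uC vC uv.
    by have := H (lv u) (lv v); rewrite adj_vl st_vl !lvK; apply; rewrite // inE /= lvK.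
  + move=> x; have [v vC xv] := wheel_center (vl x).
    by exists (lv v); [rewrite inE /= lvK | rewrite st_vl lvK].
- exact: PSO_finite_indexP (cut_undom cut) rig.
Qed.
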